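(* Let $b:[0,\infty)\to(0,\infty)$ be a $C^1$-function with $b\in L^1[0,\infty)$. Then there exists an invertible operator $W_+\in\mathcal L(E)$ and a constant $C>0$ such that for all $(u_1,u_2)\in E$ and $(v_1,v_2)=W_+(u_1,u_2)$ the corresponding solutions $u$ of $u''+2b(t)u'+Au=0$, $u(0)=u_1$, $u'(0)=u_2$, and $v$ of $v''+Av=0$, $v(0)=v_1$, $v'(0)=v_2$, satisfy for all $t\ge 0$ $$\|(u(t),u'(t))-(v(t),v'(t))\|_E\le C\,\|(u_1,u_2)\|_E\int_t^\infty b(\tau)\,d\tau ,$$ and the right-hand side tends to $0$ as $t\to\infty$.
   Context: $H$ is a separable Hilbert space with norm $\|\cdot\|$, $A$ is a closed, self-adjoint, non-negative operator in $H$ with domain $\mathcal D(A)$, and $\Lambda=\sqrt A$ with domain $\mathcal D(\Lambda)$. The abstract energy space $E$ is the closure (completion) of $(\mathcal D(\Lambda)\ominus\operatorname{Ker}\Lambda)\times H$ with respect to the norm $\|(u_1,u_2)\|_E=\|(\Lambda u_1,u_2)\|_{H\times H}$; here $\ominus\operatorname{Ker}\Lambda$ means the part orthogonal to $\operatorname{Ker}\Lambda$. The map $J(u_1,u_2)=(\Lambda u_1,u_2)$ extends to a unitary identification $J:E\to (H\ominus\operatorname{Ker}\Lambda)\times H$. $\mathcal L(E)$ denotes the bounded linear operators on $E$; invertible means with inverse in $\mathcal L(E)$. Solutions for data in $E$ are understood in the energy space: $U(t)=J(u(t),u'(t))=(\Lambda u,u')$ is the unique (mild) solution of $$U'(t)=\begin{pmatrix}0&\Lambda\\-\Lambda&-2b(t)\end{pmatrix}U(t),\qquad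 U(0)=J(u_1,u_2),$$ that is, $U\in C([0,\infty);H\times H)$ with $U(t)=\mathcal E_0(t)U(0)-\int_0^t\mathcal E_0(t-s)\begin{pmatrix}0&0\\0&2b(s)\end{pmatrix}U(s)\,ds$, where $\mathcal E_0(t)$ is the unitary group on $H\times H$ generated by the skew-adjoint operator $\begin{pmatrix}0&\Lambda\\-\Lambda&0\end{pmatrix}$ on $\mathcal D(\Lambda)\times\mathcal D(\Lambda)$. Solutions of the free problem $v''+Av=0$ are defined in the same way with $b\equiv0$. *)

(* Defs.v *)
From Stdlib Require Import Reals.
From Coquelicot Require Import Coquelicot.
Open Scope R_scope.

Inductive scalar_kind := RealScalars | ComplexScalars.

Definition scalars (F : scalar_kind) : AbsRing :=
  match F with RealScalars => R_AbsRing | ComplexScalars => C_AbsRing end.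

Definition of_real (F : scalar_kind) : R -> scalars F :=
  match F with RealScalars => fun r => r | ComplexScalars => RtoC end.

Definition re (F : scalar_kind) : scalars F -> R :=
  match F with RealScalars => fun z => z | ComplexScalars => Re end.

Definition conjugate (F : scalar_kind) : scalars F -> scalars F :=
  match F with RealScalars => fun z => z | ComplexScalars => Cconj end.

Arguments of_real {F} r.
Arguments re {F} z.
Arguments conjugate {F} z.

(** The Riemann integral [is_RInt] takes values in a normed module
    over [R]; [real_form V] is [V] with its scalars restricted to the reals,
    keeping its group structure, topology and norm. *)
Section RealForm.

Context {F : scalar_kind} (V : NormedModule (scalars F)).

Lemma real_scal_assoc (x y : R) (u : V) :
  scal (of_real x) (scal (of_real y) u) = scal (of_real (x * y)) u.
Proof.
rewrite scal_assoc; f_equal.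
now destruct F; [|symmetry; apply RtoC_mult].
Qed.

Lemma real_scal_one (u : V) : scal (of_real 1) u = u.
Proof.
replace (of_real 1 : scalars F) with (@one (scalars F)) by now destruct F.
apply scal_one.
Qed.

Lemma real_scal_distr_l (x : R) (u v : V) :
  scal (of_real x) (plus u v) = plus (scal (of_real x) u) (scal (of_real x) v).
Proof. exact (scal_distr_l (of_real x) u v). Qed.

Lemma real_scal_distr_r (x y : R) (u : V) :
  scal (of_real (x + y)) u = plus (scal (of_real x) u) (scal (of_real y) u).
Proof.
rewrite <- scal_distr_r; f_equal.
now destruct F; [|apply RtoC_plus].
Qed.

Lemma real_norm_scal (x : R) (u : V) :
  norm (scal (of_real x) u) <= Rabs x * norm u.
Proof.
replace (Rabs x) with (abs (of_real x : scalars F)).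
  apply norm_scal.
now destruct F; [|apply Cmod_R].
Qed.

Definition real_form_ModuleSpace : ModuleSpace R_AbsRing :=
  ModuleSpace.Pack R_AbsRing V
    (ModuleSpace.Class R_AbsRing V (AbelianGroup.class V)
      (ModuleSpace.Mixin R_AbsRing _ (fun (r : R) (u : V) => scal (of_real r) u)
         real_scal_assoc real_scal_one real_scal_distr_l real_scal_distr_r)) V.

Definition real_form_NormedModuleAux : NormedModuleAux R_AbsRing :=
  NormedModuleAux.Pack R_AbsRing V
    (NormedModuleAux.Class R_AbsRing V
       (ModuleSpace.class R_AbsRing real_form_ModuleSpace)
       (UniformSpace.class V)) V.

Definition real_form : NormedModule R_AbsRing :=
  NormedModule.Pack R_AbsRing V
    (NormedModule.Class R_AbsRing V
       (NormedModuleAux.class R_AbsRing real_form_NormedModuleAux)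
       (NormedModule.Mixin R_AbsRing real_form_NormedModuleAux
          (@norm _ V) (@norm_factor _ V)
          (@norm_triangle _ V) real_norm_scal
          (@norm_compat1 _ V) (@norm_compat2 _ V) (@norm_eq_zero _ V))) V.

End RealForm.

(** Linear in the first variable, conjugate-linear in the second. *)
Record is_inner {F : scalar_kind} {V : NormedModule (scalars F)}
    (ip : V -> V -> scalars F) : Prop := {
  inner_plus_l : forall x y z, ip (plus x y) z = plus (ip x z) (ip y z);
  inner_scal_l : forall a x y, ip (scal a x) y = mult a (ip x y);
  inner_conj : forall x y, ip y x = conjugate (ip x y);
  inner_norm : forall x, norm x ^ 2 = re (ip x x) }.

Record Hilbert (F : scalar_kind) := {
  hilbert_space :> CompleteNormedModule (scalars F);
  inner : hilbert_space -> hilbert_space -> scalars F;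
  inner_is_inner : is_inner inner }.

Arguments inner {F h} _ _.

Definition dense {K : AbsRing} {V : NormedModule K} (D : V -> Prop) : Prop :=
  forall (x : V) (eps : posreal), exists y, D y /\ norm (minus x y) < eps.

Definition separable {K : AbsRing} (V : NormedModule K) : Prop :=
  exists f : nat -> V, dense (fun x => exists n, x = f n).

(** The norm of [prod_NormedModule] is [sqrt (|x1|^2 + |x2|^2)], i.e. the
    Hilbert norm of the direct sum, associated with [inner2]. *)
Definition square {F : scalar_kind} (H : Hilbert F) : NormedModule (scalars F) :=
  prod_NormedModule (scalars F) H H.

Definition inner2 {F : scalar_kind} {H : Hilbert F} (x y : square H) : scalars F :=
  plus (inner (fst x) (fst y)) (inner (snd x) (snd y)).

(** The values of [app] outside [dom] are irrelevant. *)
Record operator {K : AbsRing} (V : NormedModule K) := {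
  dom : V -> Prop;
  app :> V -> V;
  dom_zero : dom zero;
  dom_plus : forall x y, dom x -> dom y -> dom (plus x y);
  dom_scal : forall a x, dom x -> dom (scal a x);
  app_plus : forall x y, dom x -> dom y -> app (plus x y) = plus (app x) (app y);
  app_scal : forall a x, dom x -> app (scal a x) = scal a (app x) }.

Arguments dom {K V} o _.
Arguments app {K V} o _.

Definition closed_operator {K : AbsRing} {V : NormedModule K} (A : operator V) : Prop :=
  closed (fun p : V * V => dom A (fst p) /\ snd p = A (fst p)).

Definition in_adjoint_graph {F : scalar_kind} {H : Hilbert F}
    (A : operator H) (y z : H) : Prop :=
  forall x, dom A x -> inner (A x) y = inner x z.

Definition selfadjoint {F : scalar_kind} {H : Hilbert F} (A : operator H) : Prop :=
  dense (dom A) /\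
  forall y z, in_adjoint_graph A y z <-> dom A y /\ z = A y.

Definition nonnegative {F : scalar_kind} {H : Hilbert F} (A : operator H) : Prop :=
  forall x, dom A x -> 0 <= re (inner (A x) x).

(** [L] is the non-negative self-adjoint square root of [A], [A = L L] being
    an equality of unbounded operators (domains included). *)
Definition is_sqrt_of {F : scalar_kind} {H : Hilbert F} (L A : operator H) : Prop :=
  selfadjoint L /\ nonnegative L /\
  (forall x, dom A x <-> dom L x /\ dom L (L x)) /\
  (forall x, dom A x -> A x = L (L x)).

Record unitary_group {F : scalar_kind} {H : Hilbert F}
    (G : R -> square H -> square H) : Prop := {
  group_plus : forall t x y, G t (plus x y) = plus (G t x) (G t y);
  group_scal : forall t a x, G t (scal a x) = scal a (G t x);
  group_inner : forall t x y, inner2 (G t x) (G t y) = inner2 x y;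
  group_zero : forall x, G 0 x = x;
  group_add : forall s t x, G (s + t) x = G s (G t x);
  group_continuous : forall x t, continuous (fun s => G s x) t }.

(** [B] is the strong derivative of the group [G] at [0]; the domain of [B] is
    the set of all vectors where this derivative exists. *)
Definition generates {F : scalar_kind} {H : Hilbert F}
    (B : operator (square H)) (G : R -> square H -> square H) : Prop :=
  forall x y : square H,
    filterlim (fun h : R => scal (of_real (/ h)) (minus (G h x) x))
      (locally' 0) (locally y)
    <-> dom B x /\ y = B x.

(** The operator matrix [(0, L; -L, 0)] on [dom L * dom L]. *)
Section WaveOperator.

Context {F : scalar_kind} {H : Hilbert F} (L : operator H).

Definition wave_dom (x : square H) : Prop := dom L (fst x) /\ dom L (snd x).

Definition wave_app (x : square H) : square H := (L (snd x), opp (L (fst x))).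

Lemma wave_dom_zero : wave_dom zero.
Proof. split; apply dom_zero. Qed.

Lemma wave_dom_plus x y : wave_dom x -> wave_dom y -> wave_dom (plus x y).
Proof. intros [? ?] [? ?]; split; apply dom_plus; assumption. Qed.

Lemma wave_dom_scal a x : wave_dom x -> wave_dom (scal a x).
Proof. intros [? ?]; split; apply dom_scal; assumption. Qed.

Lemma wave_app_plus x y : wave_dom x -> wave_dom y ->
  wave_app (plus x y) = plus (wave_app x) (wave_app y).
Proof.
intros [? ?] [? ?]; apply injective_projections; simpl.
- apply app_plus; assumption.
- etransitivity; [apply f_equal, app_plus; assumption | apply (@opp_plus H)].
Qed.

Lemma wave_app_scal a x : wave_dom x -> wave_app (scal a x) = scal a (wave_app x).
Proof.
intros [? ?]; apply injective_projections; simpl.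
- apply app_scal; assumption.
- etransitivity; [apply f_equal, app_scal; assumption | symmetry; apply (@scal_opp_r _ H)].
Qed.

Definition wave_operator : operator (square H) :=
  Build_operator _ (square H) wave_dom wave_app
    wave_dom_zero wave_dom_plus wave_dom_scal wave_app_plus wave_app_scal.

End WaveOperator.

(** [(dom L (-) Ker L) * H] *)
Definition pre_energy {F : scalar_kind} {H : Hilbert F} (L : operator H)
    (u : square H) : Prop :=
  dom L (fst u) /\
  forall w, dom L w -> L w = zero -> inner (fst u) w = zero.

(** [E], with the embedding [i], is a completion of [pre_energy L] for the norm
    [|(L u1, u2)|]; the values of [i] outside [pre_energy L] are irrelevant. *)
Record is_energy_space {F : scalar_kind} {H : Hilbert F} (L : operator H)
    (E : CompleteNormedModule (scalars F)) (i : square H -> E) : Prop := {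
  energy_plus : forall u v, pre_energy L u -> pre_energy L v ->
    i (plus u v) = plus (i u) (i v);
  energy_scal : forall a u, pre_energy L u -> i (scal a u) = scal a (i u);
  energy_norm : forall u, pre_energy L u ->
    norm (i u) = norm ((L (fst u), snd u) : square H);
  energy_dense : dense (fun e => exists u, pre_energy L u /\ e = i u) }.

(** [J] is the continuous linear extension to [E] of [(u1, u2) |-> (L u1, u2)]. *)
Definition is_energy_map {F : scalar_kind} {H : Hilbert F} (L : operator H)
    {E : CompleteNormedModule (scalars F)} (i : square H -> E)
    (J : E -> square H) : Prop :=
  is_linear J /\ forall u, pre_energy L u -> J (i u) = (L (fst u), snd u).

Definition invertible {K : AbsRing} {V : NormedModule K} (W : V -> V) : Prop :=
  is_linear W /\
  exists W' : V -> V,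
    is_linear W' /\ (forall x, W' (W x) = x) /\ (forall x, W (W' x) = x).

Definition mild_solution {F : scalar_kind} {H : Hilbert F}
    (G : R -> square H -> square H) (b : R -> R)
    (U0 : square H) (U : R -> square H) : Prop :=
  continuous_on (fun t : R => 0 <= t) U /\
  forall t, 0 <= t ->
    exists I : square H,
      @is_RInt (real_form (square H))
        (fun s => G (t - s) (zero, scal (of_real (2 * b s)) (snd (U s)))) 0 t I /\
      U t = minus (G t U0) I.

(** The [E]-valued curve [u] stands for [t |-> (u(t), u'(t))]. *)
Definition energy_solution {F : scalar_kind} {H : Hilbert F}
    {E : CompleteNormedModule (scalars F)} (J : E -> square H)
    (G : R -> square H -> square H) (b : R -> R) (u0 : E) (u : R -> E) : Prop :=
  mild_solution G b (J u0) (fun t => J (u t)).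

(** [C^1] on the closed half-line: the derivative at [0] is one-sided. *)
Definition C1_half_line (b : R -> R) : Prop :=
  exists b' : R -> R,
    (forall t, 0 <= t ->
       filterdiff b (within (fun s => 0 <= s) (locally t))
         (fun h => scal h (b' t))) /\
    continuous_on (fun t => 0 <= t) b'.

Definition tail_integral (b : R -> R) (t : R) : R :=
  RInt_gen b (at_point t) (Rbar_locally p_infty).

(* Main.v *)
Require Import Defs.
From Stdlib Require Import Reals Lra ssreflect IndefiniteDescription.
From Coquelicot Require Import Coquelicot.
Open Scope R_scope.

(** In the interaction picture the damping becomes an integrable perturbation
    of zero, and scattering theory reduces to the statement that the solutions
    of an ordinary differential equation with integrable coefficients converge.

    The free group [E0] and the projection [(x, y) |-> (0, y)] act on the image
    of [J], hence on [E]: write [T t] for the group on [E] and [P] for the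
    projection. If [u] solves the damped equation then [w t = T (-t) (u t)]
    solves [w' = 2 b(t) Q(t) w] with [Q(t) = - T(-t) P T(t)], a strongly
    continuous family of contractions ([damped_evolves]); a free solution
    becomes constant ([free_solution]). As [T] is isometric, the energy of
    [u t - v t] is the distance from [w t] to the constant of [v].

    For [w' = k(t) Q(t) w] with [k >= 0] integrable, Gronwall's inequality,
    used forwards and backwards in time, compares the norms of [w s] and [w t]
    up to a factor independent of [s] and [t] ([evolves_growth]).
    Therefore [w] moves by at most a constant times [\int_s^t k] between [s]
    and [t], so it has a limit at infinity, reached at the rate
    [\int_t^oo k]. The map [W] sends [w 0] to this limit. It is injective with
    closed range because the comparison of norms survives in the limit; its
    range is dense because the solution which passes through [y] at a late
    time [s] has a limit close to [y]. Thus [W] is bijective, with bounded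
    inverse ([scattering_operator]).

    The equation has a solution through every point (Picard iteration,
    [evolution_exists]), so [W] is defined on all of [E].

    That [T] and [P] act on [E] rests on a description of the image of [J]: it
    consists of the pairs whose first component is orthogonal to [Ker L]
    ([energy_range], [energy_range_intro]). The group preserves this condition
    since it is unitary and fixes the vectors [(n, 0)] with [n] in [Ker L]
    ([group_fixes_kernel]). *)

(** * Distances and completeness in normed modules *)

Section Groups.
Context {V : AbelianGroup}.

Lemma minus_plus_plus (a b c d : V) :
  minus (plus a b) (plus c d) = plus (minus a c) (minus b d).
Proof.
rewrite /minus opp_plus -!plus_assoc; f_equal.
by rewrite !plus_assoc (plus_comm b).
Qed.

Lemma plus_minus_cancel (x y : V) : plus (minus x y) y = x.
Proof. by rewrite /minus -plus_assoc plus_opp_l plus_zero_r. Qed.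

Lemma minus_plus_cancel (x y : V) : minus (plus x y) y = x.
Proof. by rewrite /minus -plus_assoc plus_opp_r plus_zero_r. Qed.

End Groups.

(** Over complete spaces and products, [norm (minus x y)] has several
    convertible forms, one for each group structure in which [minus] can be
    read; the constant has only one. *)
Definition distance {K : AbsRing} {V : NormedModule K} (x y : V) : R :=
  norm (minus x y).

Section Norms.
Context {K : AbsRing} {V : NormedModule K}.

Lemma distance_sym (x y : V) : distance x y = distance y x.
Proof. by rewrite /distance -opp_minus norm_opp. Qed.

Lemma distance_triangle (y x z : V) :
  distance x z <= distance x y + distance y z.
Proof. rewrite /distance (minus_trans y). exact: norm_triangle. Qed.

Lemma distance_diag (x : V) : distance x x = 0.
Proof. by rewrite /distance minus_eq_zero norm_zero. Qed.

Lemma distance_ge_0 (x y : V) : 0 <= distance x y.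
Proof. exact: norm_ge_0. Qed.

Lemma distance_minus_r (x y z : V) : distance (minus x z) (minus y z) = distance x y.
Proof.
by rewrite /distance {1}/minus opp_minus [in RHS](minus_trans z).
Qed.

Lemma distance_eq (x y : V) : (forall eps, 0 < eps -> distance x y < eps) -> x = y.
Proof.
move=> h; apply: eq_sym; apply: ball_norm_eq => -[e he] //=; exact: h.
Qed.

Lemma norm_minus_le_0 (x y : V) : norm (minus x y) <= 0 -> x = y.
Proof. move=> h; apply: distance_eq => e he; exact: Rle_lt_trans h he. Qed.

Lemma continuous_distance {U : UniformSpace} (f : U -> V) (x : U) :
  continuous f x <->
  forall eps, 0 < eps -> locally x (fun y => distance (f y) (f x) < eps).
Proof.
rewrite /continuous filterlim_locally_ball_norm; split.
- move=> h e he; exact: (h (mkposreal e he)).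
- move=> h [e he]; exact: h.
Qed.

Lemma limit_distance_le {T : Type} {F : (T -> Prop) -> Prop} {FF : ProperFilter F}
    (f : T -> V) (y z : V) (c : R) :
  filterlim f F (locally y) -> F (fun t => distance (f t) z <= c) ->
  distance y z <= c.
Proof.
move=> /filterlim_locally_ball_norm hf hc.
apply: le_epsilon => e he.
case: (filter_ex _ (filter_and _ _ (hf (mkposreal e he)) hc)) => t [/= h1 h2].
rewrite /ball_norm -/(distance (f t) y) distance_sym in h1.
apply: Rle_trans (distance_triangle (f t) _ _) _; lra.
Qed.
End Norms.

(** Completeness for families of approximations indexed by a precision, without
    choosing a sequence. It yields a limit whenever approximants at fine
    precision are close to each other: here for Picard iterates, for minimizing
    vectors in a projection, and for preimages under maps that are bounded
    below. *)
Lemma complete_approximants {K : AbsRing} {X : CompleteNormedModule K}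
    (P : R -> X -> Prop) :
  (forall d d' x, d <= d' -> P d x -> P d' x) ->
  (forall d, 0 < d -> exists x, P d x) ->
  (forall eps, 0 < eps -> exists d, 0 < d /\
     forall x y, P d x -> P d y -> distance x y < eps) ->
  exists x, forall eps, 0 < eps -> exists y, P eps y /\ distance y x < eps.
Proof.
move=> mono ex small.
pose F (Q : X -> Prop) := exists d, 0 < d /\ forall x, P d x -> Q x.
have PF : ProperFilter F.
  split.
  - move=> Q [d [hd hQ]]; case: (ex d hd) => x hx; exists x; exact: hQ.
  - split.
    + by exists 1; split; [lra|].
    + move=> Q Q' [d [hd hQ]] [d' [hd' hQ']]; exists (Rmin d d'); split.
        exact: Rmin_pos.
      move=> x hx; split; [apply: hQ|apply: hQ']; apply: mono hx.
        exact: Rmin_l.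
      exact: Rmin_r.
    + move=> Q Q' hi [d [hd hQ]]; exists d; split=> // x hx; apply: hi; exact: hQ.
have CF : cauchy F.
  move=> [e he]; case: (small e he) => d [hd hs]; case: (ex d hd) => x hx.
  exists x, d; split=> // y hy; apply: norm_compat1; exact: hs.
exists (lim F) => e he.
have hf := @norm_factor_gt_0 K X.
have he' : 0 < e / @norm_factor K X by apply: Rdiv_lt_0_compat.
case: (complete_cauchy F PF CF (mkposreal _ he')) => d [hd hQ].
case: (ex (Rmin d e) (Rmin_pos _ _ hd he)) => y hy; exists y; split.
  apply: mono hy; exact: Rmin_r.
have /hQ /norm_compat2 : P d y by apply: mono hy; exact: Rmin_l.
by rewrite /= (_ : @norm_factor K X * (e / @norm_factor K X) = e) //; field; lra.
Qed.

Lemma is_RInt_linear {U V : NormedModule R_AbsRing} (l : U -> V) (f : R -> U) a b I :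
  is_linear l -> is_RInt f a b I -> is_RInt (fun t => l (f t)) a b (l I).
Proof.
move=> hl hf.
have sumE : forall s, Riemann_sum (fun t => l (f t)) s = l (Riemann_sum f s).
  apply: SF_cons_ind => [x|h s IH].
    by rewrite /Riemann_sum /= linear_zero.
  by rewrite !Riemann_sum_cons (linear_plus _ hl) (linear_scal _ hl) IH.
rewrite /is_RInt.
apply: (filterlim_ext (fun s => l (scal (sign (b - a)) (Riemann_sum f s)))).
  by move=> s; rewrite (linear_scal _ hl) sumE.
apply: filterlim_comp hf _; exact: linear_cont.
Qed.

(** * Integrals and Gronwall's inequality *)

Lemma continuous_apply {K : AbsRing} {U V : NormedModule K} (Q : R -> U -> V)
    (w : R -> U) (t : R) :
  (forall r, is_linear (Q r)) -> (forall r x, norm (Q r x) <= norm x) ->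
  (forall x, continuous (fun r => Q r x) t) -> continuous w t ->
  continuous (fun r => Q r (w r)) t.
Proof.
move=> lin contr cont /continuous_distance cw.
apply/continuous_distance => e he.
have he2 : 0 < e / 2 by lra.
have /continuous_distance cQ := cont (w t).
apply: filter_imp (filter_and _ _ (cw _ he2) (cQ _ he2)) => r [h1 h2].
apply: Rle_lt_trans (distance_triangle (Q r (w t)) _ _) _.
rewrite {1}/distance -linear_minus //.
apply: Rle_lt_trans (Rplus_le_compat_r _ _ _ (contr _ _)) _.
rewrite -/(distance (w r) (w t)); lra.
Qed.

Lemma ex_RInt_cont {V : CompleteNormedModule R_AbsRing} (f : R -> V) a b :
  (forall t, continuous f t) -> is_RInt f a b (RInt f a b).
Proof. by move=> cf; apply: RInt_correct; apply: ex_RInt_continuous => z _. Qed.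

Lemma is_derive_RInt_cont {V : CompleteNormedModule R_AbsRing} (f : R -> V) a t :
  (forall t, continuous f t) -> is_derive (fun t => RInt f a t) t (f t).
Proof.
move=> cf; apply: (is_derive_RInt _ _ a) => //.
by apply: filter_forall => b; exact: ex_RInt_cont.
Qed.

(** The orientation [sg = 1] or [sg = -1] is that of the interval from [a] to
    [b], so that forward and backward evolution have the same estimates. *)
Lemma norm_RInt_le_oriented {V : NormedModule R_AbsRing} (sg : R) (f : R -> V)
    (g : R -> R) (a b : R) (I : V) (G : R) :
  sg = 1 \/ sg = -1 -> 0 <= sg * (b - a) ->
  (forall t, Rmin a b <= t <= Rmax a b -> norm (f t) <= g t) ->
  is_RInt f a b I -> is_RInt g a b G -> norm I <= sg * G.
Proof.
case=> -> hab.
  rewrite Rmin_left ?Rmax_right; try lra.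
  rewrite Rmult_1_l => h hf hg; apply: (norm_RInt_le f g a b _ _ _ h hf hg); lra.
rewrite Rmin_right ?Rmax_left; try lra.
move=> h /is_RInt_swap hf /is_RInt_swap hg.
rewrite -norm_opp (_ : -1 * G = opp G); last by rewrite /opp /=; ring.
apply: (norm_RInt_le f g b a _ _ _ h hf hg); lra.
Qed.

(** With [phi t] the right-hand side of the assumed inequality, the function
    [phi t * exp (- sg * kappa t)] is nonincreasing in the direction from [s]
    to [T]. *)
Lemma gronwall (f k kappa : R -> R) (sg c s T : R) :
  (forall t, continuous f t) -> (forall t, continuous k t) -> (forall t, 0 <= k t) ->
  (forall t, is_derive kappa t (k t)) ->
  0 <= sg * (T - s) ->
  (forall t, Rmin s T <= t <= Rmax s T ->
     f t <= c + sg * RInt (fun r => k r * f r) s t) ->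
  f T <= c * exp (sg * (kappa T - kappa s)).
Proof.
move=> cf ck k0 dk hT h.
have ckf : forall t, continuous (fun r => k r * f r) t.
  by move=> t; apply: (@continuous_mult _ R_AbsRing).
have [G [GE dG]] : exists G : R -> R,
    (forall t, RInt (fun r => k r * f r) s t = G t) /\
    forall t, is_derive G t (k t * f t).
  exists (fun t => RInt (fun r => k r * f r) s t); split=> // t.
  exact: (@is_derive_RInt_cont R_CompleteNormedModule).
pose phi t := c + sg * G t.
pose g t := phi t * exp (- sg * kappa t).
have dphi t : is_derive phi t (sg * (k t * f t)).
  rewrite /phi; auto_derive; first by exists (k t * f t).
  rewrite (is_derive_unique _ _ _ (dG t)); ring.
have dg t : is_derive g t (sg * k t * (f t - phi t) * exp (- sg * kappa t)).
  rewrite /g; auto_derive.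
    split; first by exists (sg * (k t * f t)).
    by split; first by exists (k t).
  rewrite (is_derive_unique _ _ _ (dphi t)) (is_derive_unique _ _ _ (dk t)); ring.
have [|z _|z [hz hgz]] := MVT_gen g s T
    (fun t => sg * k t * (f t - phi t) * exp (- sg * kappa t)).
- by move=> z _.
- apply/continuity_pt_filterlim; apply: ex_derive_continuous.
  by eexists; apply: dg.
have gle : g T <= g s.
  have e0 := exp_pos (- sg * kappa z).
  have fz := h z hz; rewrite GE -/(phi z) in fz.
  have -> : g T = g s - k z * (phi z - f z) * exp (- sg * kappa z) * (sg * (T - s)).
    have -> : g T = g s + (g T - g s) by ring.
    rewrite hgz; ring.
  suff : 0 <= k z * (phi z - f z) * exp (- sg * kappa z) * (sg * (T - s)) by lra.
  apply: Rmult_le_pos => //; apply: Rmult_le_pos; last lra.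
  apply: Rmult_le_pos; [exact: k0|lra].
have fT : f T <= phi T.
  by rewrite /phi -GE; apply: h; split; [exact: Rmin_r|exact: Rmax_r].
have phis : phi s = c by rewrite /phi -GE RInt_point /zero /=; ring.
apply: Rle_trans fT _.
have -> : phi T = g T * exp (sg * kappa T).
  rewrite /g Rmult_assoc -exp_plus.
  have -> : - sg * kappa T + sg * kappa T = 0 by ring.
  by rewrite exp_0 Rmult_1_r.
have -> : c * exp (sg * (kappa T - kappa s)) = g s * exp (sg * kappa T).
  rewrite /g phis Rmult_assoc -exp_plus; do 2 f_equal; ring.
apply: Rmult_le_compat_r gle; exact: Rlt_le (exp_pos _).
Qed.

(** * Linear evolution equations with integrable coefficients *)

Lemma exp_le x y : x <= y -> exp x <= exp y.
Proof.
case=> [h|->]; [exact: Rlt_le (exp_increasing _ _ h)|exact: Rle_refl].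
Qed.

Definition halves (n : nat) : R := (1/2) ^ n.

Lemma halves_0 : halves 0 = 1.
Proof. by []. Qed.

Lemma halves_S n : halves (S n) = halves n / 2.
Proof. rewrite /halves /=; field. Qed.

Lemma halves_add n m : halves (n + m) = halves n * halves m.
Proof. exact: pow_add. Qed.

Lemma halves_pos n : 0 < halves n.
Proof. by apply: pow_lt; lra. Qed.

Lemma halves_small (c e : R) : 0 < e -> exists n, c * halves n < e.
Proof.
move=> he; have hq : Rabs (1/2) < 1 by rewrite Rabs_pos_eq; lra.
have ac := Rabs_pos c.
have he' : 0 < e / (Rabs c + 1) by apply: Rdiv_lt_0_compat; lra.
case: (pow_lt_1_zero _ hq _ he') => n /(_ n (le_n _)) hn; exists n.
move: hn; rewrite -/(halves n) Rabs_pos_eq; last exact: Rlt_le (halves_pos n).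
move=> /(Rmult_lt_compat_l (Rabs c + 1)) H.
have : (Rabs c + 1) * halves n < e.
  have -> : e = (Rabs c + 1) * (e / (Rabs c + 1)) by field; lra.
  apply: H; lra.
have := Rle_abs c; have := halves_pos n; nra.
Qed.

Lemma geometric_limit {K : AbsRing} {X : CompleteNormedModule K} (p : nat -> X) (c : R) :
  (forall n, distance (p (S n)) (p n) <= c * halves n) ->
  exists w, forall n, distance (p n) w <= 2 * c * halves n.
Proof.
move=> step.
have q0 := halves_pos.
have c0 : 0 <= c.
  have := distance_ge_0 (p 1%nat) (p 0%nat); have := step 0%nat.
  by rewrite halves_0; lra.
have far n m : distance (p (n + m)%nat) (p n) <= 2 * c * halves n * (1 - halves m).
  elim: m => [|m IH].
    rewrite -plus_n_O distance_diag halves_0; lra.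
  rewrite -plus_n_Sm; apply: Rle_trans (distance_triangle (p (n + m)%nat) _ _) _.
  have := step (n + m)%nat; rewrite halves_S halves_add; nra.
have far2 n m : distance (p n) (p m) <= 2 * c * halves n + 2 * c * halves m.
  have pos j : 0 <= 2 * c * halves j by have := q0 j; nra.
  have fle a d : distance (p (a + d)%nat) (p a) <= 2 * c * halves a.
    apply: Rle_trans (far a d) _; have := pos a; have := q0 d; nra.
  case: (Nat.le_ge_cases n m) => hnm.
    rewrite distance_sym (_ : m = (n + (m - n))%nat); last by symmetry; rewrite Nat.add_comm; apply: Nat.sub_add.
    by have := fle n (m - n)%nat; have := pos (n + (m - n))%nat; lra.
  rewrite (_ : n = (m + (n - m))%nat); last by symmetry; rewrite Nat.add_comm; apply: Nat.sub_add.
  by have := fle m (n - m)%nat; have := pos (m + (n - m))%nat; lra.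
have small e : 0 < e -> exists n, 2 * c * halves n <= e.
  by move=> /(halves_small (2 * c)) [n hn]; exists n; exact: Rlt_le.
case: (complete_approximants (fun d x => exists n, x = p n /\ 2 * c * halves n <= d)).
- by move=> d d' x hd [n [-> hn]]; exists n; split=> //; lra.
- by move=> d /small [n hn]; exists (p n), n.
- move=> e he; exists (e / 4); split; first lra.
  by move=> x y [n [-> hn]] [m [-> hm]]; have := far2 n m; lra.
move=> w hw; exists w => n; apply: le_epsilon => e he.
have he2 : 0 < e / 2 by lra.
case: (hw _ he2) => y [[m [-> hm]] hmw].
by have := distance_triangle (p m) (p n) w; have := far2 n m; lra.
Qed.

Lemma orientation (s t : R) : exists sg, (sg = 1 \/ sg = -1) /\ 0 <= sg * (t - s).
Proof.
case: (Rle_dec s t) => h; [exists 1|exists (-1)]; split; lra.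
Qed.

(** The equation [w' = k(t) Q(t) w], where [Q] is a strongly continuous family
    of contractions and [kappa] a bounded primitive of [k >= 0]. *)
Section Evolution.

Context {X : CompleteNormedModule R_AbsRing}.
Variables (Q : R -> X -> X) (k kappa : R -> R) (K : R).
Hypothesis Q_linear : forall r, is_linear (Q r).
Hypothesis Q_contr : forall r x, norm (Q r x) <= norm x.
Hypothesis Q_cont : forall x r, continuous (fun s => Q s x) r.
Hypothesis k_cont : forall r, continuous k r.
Hypothesis k_ge0 : forall r, 0 <= k r.
Hypothesis kappa_derive : forall r, is_derive kappa r (k r).
Hypothesis kappa_bound : forall r, Rabs (kappa r) <= K.

Definition vector_field (w : R -> X) (r : R) : X := scal (k r) (Q r (w r)).

Lemma vector_field_continuous w :
  (forall r, continuous w r) -> forall r, continuous (vector_field w) r.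
Proof.
move=> cw r; apply: (continuous_scal k (fun r => Q r (w r))); first exact: k_cont.
exact: continuous_apply.
Qed.

Lemma norm_vector_field w r : norm (vector_field w r) <= k r * norm (w r).
Proof.
apply: Rle_trans (norm_scal _ _) _; rewrite /abs /= Rabs_pos_eq //.
exact: Rmult_le_compat_l.
Qed.

Lemma kappa_mono sg s t : sg = 1 \/ sg = -1 -> 0 <= sg * (t - s) -> forall r,
  Rmin s t <= r <= Rmax s t -> 0 <= sg * (kappa r - kappa s).
Proof.
move=> sg2 hst r hr.
have [|z _|z [_ ->]] := MVT_gen kappa s r k.
- by move=> z _.
- by apply/continuity_pt_filterlim; apply: ex_derive_continuous; exists (k z).
have : 0 <= sg * (r - s).
  move: hr hst; rewrite /Rmin /Rmax; case: Rle_dec => h hr; case: sg2 => ->; lra.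
have := k_ge0 z; nra.
Qed.

Lemma kappa_diff_bound r s : Rabs (kappa r - kappa s) <= 2 * K.
Proof.
apply: Rle_trans (Rabs_triang _ _) _; rewrite Rabs_Ropp.
by have := kappa_bound r; have := kappa_bound s; lra.
Qed.

(** The Picard map is a contraction with factor 1/2 for the weight
    [exp (2 |kappa t - kappa s|)], because [k] times the weight is, up to the
    orientation, half of the derivative of the weight. *)
Lemma weighted_bound (f : R -> X) s t (c : R) (I : X) : 0 <= c ->
  (forall r, norm (f r) <= k r * (c * exp (2 * Rabs (kappa r - kappa s)))) ->
  is_RInt f s t I -> norm I <= c / 2 * exp (2 * Rabs (kappa t - kappa s)).
Proof.
move=> c0 hf hI.
case: (orientation s t) => sg [sg2 hst].
have sg1 : Rabs sg = 1 by case: sg2 => ->; rewrite ?Rabs_Ropp Rabs_R1.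
have absE r : Rmin s t <= r <= Rmax s t ->
    Rabs (kappa r - kappa s) = sg * (kappa r - kappa s).
  move=> hr; have h := kappa_mono _ _ _ sg2 hst r hr.
  by rewrite -(Rabs_pos_eq _ h) Rabs_mult sg1 Rmult_1_l.
pose g r := sg * (c / 2) * exp (2 * (sg * (kappa r - kappa s))).
have dg r : is_derive g r (k r * (c * exp (2 * (sg * (kappa r - kappa s))))).
  rewrite /g; auto_derive; first by exists (k r).
  rewrite (is_derive_unique _ _ _ (kappa_derive r)).
  have -> : forall e, sg * (c / 2) * (2 * (sg * (1 * k r)) * e) = (sg * sg) * (k r * (c * e)).
    by move=> e; field.
  have -> : sg * sg = 1 by case: sg2 => ->; ring.
  rewrite /Rminus; ring.
have hG := is_RInt_derive g (fun r => k r * (c * exp (2 * (sg * (kappa r - kappa s))))) s t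
             (fun r _ => dg r).
apply: Rle_trans (norm_RInt_le_oriented sg _ _ _ _ _ _ sg2 hst _ hI (hG _)) _.
- by move=> r hr; rewrite -absE.
- move=> r _; apply: (@continuous_mult _ R_AbsRing); first exact: k_cont.
  apply: (@continuous_mult _ R_AbsRing); first exact: continuous_const.
  apply: ex_derive_continuous; auto_derive; by exists (k r).
rewrite /minus /plus /opp /= /g Rminus_diag Rmult_0_r Rmult_0_r exp_0.
have ht := absE t (conj (Rmin_r _ _) (Rmax_r _ _)).
rewrite -ht.
have : 1 <= exp (2 * Rabs (kappa t - kappa s)).
  by have := exp_ineq1_le (2 * Rabs (kappa t - kappa s)); have := Rabs_pos (kappa t - kappa s); lra.
set e := exp _ => he.
have -> : sg * (sg * (c / 2) * e + - (sg * (c / 2) * 1)) = sg * sg * (c / 2 * (e - 1)).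
  by ring.
have -> : sg * sg = 1 by case: sg2 => ->; ring.
nra.
Qed.

Fixpoint picard (s : R) (x : X) (n : nat) : R -> X :=
  match n with
  | O => fun _ => x
  | S n => fun t => plus x (RInt (vector_field (picard s x n)) s t)
  end.

Lemma picard_continuous s x n t : continuous (picard s x n) t.
Proof.
elim: n t => [|n IH] t /=; first exact: continuous_const.
apply: continuous_plus; first exact: continuous_const.
apply: ex_derive_continuous; eexists; apply: is_derive_RInt_cont.
exact: vector_field_continuous.
Qed.

Lemma vector_field_minus w w' r :
  minus (vector_field w r) (vector_field w' r) =
  vector_field (fun r => minus (w r) (w' r)) r.
Proof. by rewrite /vector_field linear_minus // scal_minus_distr_l. Qed.

Lemma picard_step s x n t :
  distance (picard s x (S n) t) (picard s x n t)
    <= norm x * halves n * exp (2 * Rabs (kappa t - kappa s)).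
Proof.
have q0 := halves_pos.
elim: n t => [|n IH] t.
  rewrite /distance /= plus_comm minus_plus_cancel.
  apply: Rle_trans (weighted_bound (vector_field (fun _ => x)) s t (norm x) _ _ _ _) _.
  - exact: norm_ge_0.
  - move=> r; apply: Rle_trans (norm_vector_field _ _) _; apply: Rmult_le_compat_l => //.
    have := exp_ineq1_le (2 * Rabs (kappa r - kappa s)).
    have := Rabs_pos (kappa r - kappa s); have := norm_ge_0 x; nra.
  - by apply: ex_RInt_cont; apply: vector_field_continuous => r; exact: continuous_const.
  - apply: Rmult_le_compat_r; first exact: Rlt_le (exp_pos _).
    rewrite halves_0; have := norm_ge_0 x; lra.
rewrite /distance.
have -> : minus (picard s x (S (S n)) t) (picard s x (S n) t) =
    minus (RInt (vector_field (picard s x (S n))) s t) (RInt (vector_field (picard s x n)) s t).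
  by rewrite [LHS]/= minus_plus_plus minus_eq_zero plus_zero_l.
have -> : norm x * halves (S n) = (norm x * halves n) / 2 by rewrite halves_S; field.
apply: (weighted_bound (fun r => minus (vector_field (picard s x (S n)) r) (vector_field (picard s x n) r))).
- by have := norm_ge_0 x; have := q0 n; nra.
- move=> r; rewrite vector_field_minus; apply: Rle_trans (norm_vector_field _ _) _.
  apply: Rmult_le_compat_l => //; exact: IH.
- by apply: is_RInt_minus; apply: ex_RInt_cont; apply: vector_field_continuous => r;
    exact: picard_continuous.
Qed.

Lemma weight_bound t s : exp (2 * Rabs (kappa t - kappa s)) <= exp (4 * K).
Proof. by apply: exp_le; have := kappa_diff_bound t s; lra. Qed.

(** The weight is bounded, so the Picard iterates converge uniformly on the
    whole line. Starting at an arbitrary time [s] matters for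
    [asymptotic_dense]. *)
Lemma evolution_exists s x : exists w : R -> X,
  (forall t, continuous w t) /\
  forall t, is_RInt (vector_field w) s t (minus (w t) x).
Proof.
have q0 := halves_pos.
pose c := norm x * exp (4 * K).
have [w hw] : exists w : R -> X,
    forall t n, distance (picard s x n t) (w t) <= 2 * c * halves n.
  apply: (functional_choice (fun t y =>
     forall n, distance (picard s x n t) y <= 2 * c * halves n)) => t.
  apply: geometric_limit => n.
  apply: Rle_trans (picard_step s x n t) _.
  have a0 : 0 <= norm x * halves n.
    by apply: Rmult_le_pos; [exact: norm_ge_0|exact: Rlt_le].
  by have := Rmult_le_compat_l _ _ _ a0 (weight_bound t s); rewrite /c; lra.
have cw t : continuous w t.
  apply/continuous_distance => e he.
  have he3 : 0 < e / 3 by lra.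
  case: (halves_small (2 * c) _ he3) => n hn.
  have /continuous_distance /(_ _ he3) := picard_continuous s x n t.
  apply: filter_imp => r hr.
  have h1 := distance_triangle (picard s x n r) (w r) (w t).
  have h2 := distance_triangle (picard s x n t) (picard s x n r) (w t).
  have h3 := hw r n; rewrite distance_sym in h3; have h4 := hw t n; lra.
exists w; split=> // t.
suff -> : minus (w t) x = RInt (vector_field w) s t by apply: ex_RInt_cont; exact: vector_field_continuous.
apply: distance_eq => e he.
have c0 : 0 <= c by apply: Rmult_le_pos; [exact: norm_ge_0|exact: Rlt_le (exp_pos _)].
have e40 := exp_pos (4 * K).
case: (halves_small (2 * c + 2 * c * exp (4 * K)) _ he) => n hn.
have hint : distance (RInt (vector_field (picard s x n)) s t) (RInt (vector_field w) s t)
    <= 2 * c * halves n / 2 * exp (2 * Rabs (kappa t - kappa s)).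
  apply: (weighted_bound (fun r => minus (vector_field (picard s x n) r) (vector_field w r))).
  - by have := q0 n; nra.
  - move=> r; rewrite vector_field_minus; apply: Rle_trans (norm_vector_field _ _) _.
    apply: Rmult_le_compat_l => //; apply: Rle_trans (hw r n) _.
    have := exp_ineq1_le (2 * Rabs (kappa r - kappa s)).
    have := Rabs_pos (kappa r - kappa s).
    have : 0 <= 2 * c * halves n by have := q0 n; nra.
    by nra.
  - by apply: is_RInt_minus; apply: ex_RInt_cont; apply: vector_field_continuous => // r;
      exact: picard_continuous.
have hS := hw t (S n); rewrite distance_sym in hS.
have E1 : minus (picard s x (S n) t) x = RInt (vector_field (picard s x n)) s t.
  by rewrite [picard _ _ _ _]/= plus_comm minus_plus_cancel.
have h1 := distance_triangle (minus (picard s x (S n) t) x) (minus (w t) x) (RInt (vector_field w) s t).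
have E2 : distance (minus (w t) x) (minus (picard s x (S n) t) x)
    = distance (w t) (picard s x (S n) t) by exact: distance_minus_r.
rewrite E2 E1 in h1; rewrite halves_S in hS.
have wb := weight_bound t s.
have : 2 * c * halves n / 2 * exp (2 * Rabs (kappa t - kappa s)) <= c * halves n * exp (4 * K).
  have -> : 2 * c * halves n / 2 = c * halves n by field.
  apply: Rmult_le_compat_l wb; have := q0 n; nra.
have : 0 <= c * halves n * exp (4 * K) by apply: Rmult_le_pos; [have := q0 n; nra|lra].
have : 0 <= c * halves n by have := q0 n; nra.
lra.
Qed.

(** Only nonnegative times are constrained: there the damping is given, and the
    values at negative times are those of a continuous extension. *)
Definition evolves (w : R -> X) : Prop :=
  (forall t, continuous w t) /\
  forall t, 0 <= t -> is_RInt (vector_field w) 0 t (minus (w t) (w 0)).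

Lemma evolves_between w s t : evolves w -> 0 <= s -> 0 <= t ->
  is_RInt (vector_field w) s t (minus (w t) (w s)).
Proof.
move=> [_ h] hs ht.
have := is_RInt_Chasles _ _ _ _ _ _ (is_RInt_swap _ _ _ _ (h s hs)) (h t ht).
by rewrite opp_minus plus_comm -minus_trans.
Qed.

Lemma evolves_through s x : exists w, evolves w /\ w s = x.
Proof.
case: (evolution_exists s x) => w [cw hw].
have ws : w s = x.
  rewrite -[LHS](plus_minus_cancel (w s) x).
  have hs := filterlim_locally_unique _ _ _ (hw s) (is_RInt_point (vector_field w) s).
  by rewrite hs plus_zero_l.
exists w; split=> //; split=> // t _.
have := is_RInt_Chasles _ _ _ _ _ _ (is_RInt_swap _ _ _ _ (hw 0)) (hw t).
by rewrite opp_minus plus_comm -minus_trans.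
Qed.

(** A bound for [exp |kappa t - kappa s|]. *)
Definition growth : R := exp (2 * K).

(** The norms at any two times are comparable, since Gronwall's inequality holds
    in both directions of time. *)
Lemma evolves_growth w s t : evolves w -> 0 <= s -> 0 <= t ->
  norm (w t) <= growth * norm (w s).
Proof.
move=> hw hs ht; case: (orientation s t) => sg [sg2 hst].
have cn r : continuous (fun r => norm (w r)) r.
  apply: continuous_comp; [by case: hw => cw _; exact: cw|exact: filterlim_norm].
have g := gronwall (fun r => norm (w r)) k kappa sg (norm (w s)) s t
  cn k_cont k_ge0 kappa_derive hst.
rewrite Rmult_comm; apply: Rle_trans (g _) _.
  move=> r hr.
  have r0 : 0 <= r by apply: Rle_trans (proj1 hr); exact: Rmin_glb.
  have hsr : 0 <= sg * (r - s).
    move: hr hst; rewrite /Rmin /Rmax; case: Rle_dec => h hr; case: sg2 => ->; lra.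
  rewrite -[in X in X <= _](plus_minus_cancel (w r) (w s)) plus_comm.
  apply: Rle_trans (norm_triangle _ _) _; apply: Rplus_le_compat_l.
  apply: (norm_RInt_le_oriented sg (vector_field w) (fun r => k r * norm (w r)) s r) => //.
  - by move=> z _; exact: norm_vector_field.
  - exact: evolves_between.
  - apply: (@ex_RInt_cont R_CompleteNormedModule) => z.
    exact: (@continuous_mult _ R_AbsRing).
apply: Rmult_le_compat_l; first exact: norm_ge_0.
apply: exp_le; apply: Rle_trans (Rle_abs _) _; rewrite Rabs_mult.
rewrite (_ : Rabs sg = 1); last by case: sg2 => ->; rewrite ?Rabs_Ropp Rabs_R1.
rewrite Rmult_1_l; exact: kappa_diff_bound.
Qed.

Lemma evolves_drift w s t : evolves w -> 0 <= s <= t ->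
  distance (w t) (w s) <= growth * norm (w 0) * (kappa t - kappa s).
Proof.
move=> hw [hs hst].
have hk : is_RInt k s t (kappa t - kappa s).
  exact: (@is_RInt_derive R_CompleteNormedModule kappa k).
have hg := is_RInt_scal k s t (growth * norm (w 0)) _ hk.
apply: (norm_RInt_le (vector_field w) _ s t _ _ hst _ _ hg); last by apply: evolves_between => //; lra.
move=> r hr; apply: Rle_trans (norm_vector_field _ _) _; rewrite Rmult_comm.
apply: Rmult_le_compat_r => //; apply: evolves_growth => //; lra.
Qed.

Variable kappa_oo : R.
Hypothesis kappa_lim : filterlim kappa (Rbar_locally p_infty) (locally kappa_oo).

Lemma kappa_le s t : s <= t -> kappa s <= kappa t.
Proof.
move=> hst; have h0 : 0 <= 1 * (t - s) by lra.
have := kappa_mono 1 s t (or_introl eq_refl) h0 t (conj (Rmin_r _ _) (Rmax_r _ _)); lra.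
Qed.

Lemma kappa_le_lim t : kappa t <= kappa_oo.
Proof.
apply: (filterlim_le (F := Rbar_locally p_infty) (fun _ => kappa t) kappa (kappa t) kappa_oo) => //.
- by exists t => r hr; apply: kappa_le; lra.
- exact: filterlim_const.
Qed.

Lemma kappa_near_lim eps : 0 < eps -> exists T, 0 <= T /\ kappa_oo - kappa T < eps.
Proof.
move=> he; have /filterlim_locally /(_ (mkposreal _ he)) [M hM] := kappa_lim.
exists (Rmax 0 (M + 1)); split; first exact: Rmax_l.
have /hM /Rabs_def2 : M < Rmax 0 (M + 1) by have := Rmax_r 0 (M + 1); lra.
rewrite /minus /plus /opp /=; lra.
Qed.

Lemma growth_pos : 0 < growth.
Proof. exact: exp_pos. Qed.

Lemma evolves_converges w : evolves w ->
  exists y, filterlim w (Rbar_locally p_infty) (locally y).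
Proof.
move=> hw; apply/filterlim_locally_cauchy => eps.
pose c := growth * norm (w 0).
have c0 : 0 <= c by apply: Rmult_le_pos; [exact: Rlt_le growth_pos|exact: norm_ge_0].
have he : 0 < eps / 2 / (c + 1) by apply: Rdiv_lt_0_compat; have := cond_pos eps; lra.
case: (kappa_near_lim _ he) => T [T0 hT].
have near u : T < u -> distance (w u) (w T) < eps / 2.
  move=> hu; apply: Rle_lt_trans (evolves_drift w T u hw _) _; first lra.
  rewrite -/c; have := kappa_le_lim u; have := kappa_le T u (Rlt_le _ _ hu) => h1 h2.
  have -> : pos eps / 2 = (c + 1) * (eps / 2 / (c + 1)) by field; lra.
  apply: Rle_lt_trans (_ : (c + 1) * (kappa u - kappa T) < _); first nra.
  apply: Rmult_lt_compat_l; lra.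
exists (fun u => T < u); split; first by exists T.
move=> u v hu hv; apply: norm_compat1; rewrite -/(distance (w v) (w u)).
have := distance_triangle (w T) (w v) (w u); have := near u hu; have := near v hv.
rewrite (distance_sym (w T)); lra.
Qed.

Lemma evolves_rate w y t : evolves w -> 0 <= t ->
  filterlim w (Rbar_locally p_infty) (locally y) ->
  distance (w t) y <= growth * norm (w 0) * (kappa_oo - kappa t).
Proof.
move=> hw ht hy; rewrite distance_sym; apply: (limit_distance_le w) hy _.
exists t => r hr; apply: Rle_trans (evolves_drift w t r hw _) _; first lra.
apply: Rmult_le_compat_l; last by have := kappa_le_lim r; lra.
by apply: Rmult_le_pos; [exact: Rlt_le growth_pos|exact: norm_ge_0].
Qed.

(** The graph of the scattering operator. *)
Definition asymptotic (x y : X) : Prop :=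
  exists w, evolves w /\ w 0 = x /\ filterlim w (Rbar_locally p_infty) (locally y).

Lemma asymptotic_bound x y : asymptotic x y -> norm y <= growth * norm x.
Proof.
move=> [w [hw [<- hy]]]; rewrite -(minus_zero_r y); apply: (limit_distance_le w) hy _.
exists 0 => r hr; rewrite /distance minus_zero_r; apply: evolves_growth => //; lra.
Qed.

Lemma asymptotic_inverse_bound x y : asymptotic x y -> norm x <= growth * norm y.
Proof.
move=> [w [hw [<- hy]]]; apply: le_epsilon => e he.
have he' : 0 < e / growth by apply: Rdiv_lt_0_compat => //; exact: growth_pos.
have /filterlim_locally_ball_norm /(_ (mkposreal _ he')) h := hy.
have h0 : Rbar_locally p_infty (fun t => 0 < t) by exists 0.
case: (filter_ex _ (filter_and _ _ h h0)) => t [/= ht t0].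
have {}ht : distance (w t) y < e / growth := ht.
apply: Rle_trans (evolves_growth w t 0 hw _ _) _; try lra.
have -> : growth * norm y + e = growth * (norm y + e / growth).
  by field; have := growth_pos; lra.
apply: Rmult_le_compat_l; first exact: Rlt_le growth_pos.
rewrite -[in X in X <= _](plus_minus_cancel (w t) y) plus_comm.
apply: Rle_trans (norm_triangle _ _) _; apply: Rplus_le_compat_l; exact: Rlt_le.
Qed.

Lemma asymptotic_plus x y x' y' : asymptotic x y -> asymptotic x' y' ->
  asymptotic (plus x x') (plus y y').
Proof.
move=> [w [[cw hw] [<- hy]]] [w' [[cw' hw'] [<- hy']]].
exists (fun t => plus (w t) (w' t)); split; [split|split=> //].
- by move=> t; apply: continuous_plus.
- move=> t ht; rewrite minus_plus_plus.
  apply: is_RInt_ext (is_RInt_plus _ _ _ _ _ _ (hw t ht) (hw' t ht)) => r _.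
  by rewrite /vector_field (linear_plus _ (Q_linear r)) scal_distr_l.
- exact: filterlim_comp_2 hy hy' (filterlim_plus _ _).
Qed.

(** Operators that commute with the coefficients commute with scattering. For
    complex scalars this recovers complex linearity, although the evolution
    is set up over the reals. *)
Lemma asymptotic_map l x y : is_linear l -> (forall r z, l (Q r z) = Q r (l z)) ->
  asymptotic x y -> asymptotic (l x) (l y).
Proof.
move=> hl lQ [w [[cw hw] [<- hy]]].
exists (fun t => l (w t)); split; [split|split=> //].
- by move=> t; apply: continuous_comp => //; exact: linear_cont.
- move=> t ht; rewrite -linear_minus //.
  apply: is_RInt_ext (is_RInt_linear l _ _ _ _ hl (hw t ht)) => r _.
  by rewrite /vector_field (linear_scal _ hl) lQ.
- apply: filterlim_comp hy _; exact: linear_cont.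
Qed.

Lemma asymptotic_minus x y x' y' : asymptotic x y -> asymptotic x' y' ->
  asymptotic (minus x x') (minus y y').
Proof.
move=> h h'; apply: asymptotic_plus => //; apply: asymptotic_map h'.
  exact: is_linear_opp.
by move=> r z; rewrite linear_opp.
Qed.

Lemma asymptotic_total x : exists y, asymptotic x y.
Proof.
case: (evolves_through 0 x) => w [hw w0]; case: (evolves_converges w hw) => y hy.
by exists y, w.
Qed.

Lemma asymptotic_unique x y y' : asymptotic x y -> asymptotic x y' -> y = y'.
Proof.
move=> h h'; apply: norm_minus_le_0.
apply: Rle_trans (asymptotic_bound _ _ (asymptotic_minus _ _ _ _ h h')) _.
by rewrite minus_eq_zero norm_zero Rmult_0_r; exact: Rle_refl.
Qed.

Lemma asymptotic_injective x x' y : asymptotic x y -> asymptotic x' y -> x = x'.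
Proof.
move=> h h'; apply: norm_minus_le_0.
apply: Rle_trans (asymptotic_inverse_bound _ _ (asymptotic_minus _ _ _ _ h h')) _.
by rewrite minus_eq_zero norm_zero Rmult_0_r; exact: Rle_refl.
Qed.

(** The solution that equals [y] at time [T] ends close to [y] when little
    damping is left after [T], and its initial value is bounded independently
    of [T]. *)
Lemma asymptotic_dense y eps : 0 < eps ->
  exists x y', asymptotic x y' /\ distance y' y < eps.
Proof.
move=> he; pose c := growth * (growth * norm y).
have g0 := growth_pos.
have c0 : 0 <= c.
  by apply: Rmult_le_pos; [lra|apply: Rmult_le_pos; [lra|exact: norm_ge_0]].
have he' : 0 < eps / (c + 1) by apply: Rdiv_lt_0_compat; lra.
case: (kappa_near_lim _ he') => T [T0 hT].
case: (evolves_through T y) => w [hw wT]; case: (evolves_converges w hw) => y' hy'.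
exists (w 0), y'; split; first by exists w.
have := evolves_rate w y' T hw T0 hy'; rewrite wT distance_sym => h.
apply: Rle_lt_trans h _.
have h0 := evolves_growth w T 0 hw T0 (Rle_refl 0); rewrite wT in h0.
have hk := kappa_le_lim T.
apply: Rle_lt_trans (_ : (c + 1) * (kappa_oo - kappa T) < _).
  apply: Rmult_le_compat_r; first lra.
  have : growth * norm (w 0) <= c by apply: Rmult_le_compat_l; lra.
  lra.
have -> : eps = (c + 1) * (eps / (c + 1)) by field; lra.
apply: Rmult_lt_compat_l; lra.
Qed.

(** The range is dense, and closed since [asymptotic_inverse_bound] makes the
    preimages of nearby points close to each other. *)
Lemma asymptotic_surjective y : exists x, asymptotic x y.
Proof.
have g0 := growth_pos.
case: (complete_approximants
  (fun d x => exists y', asymptotic x y' /\ distance y' y < d)).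
- by move=> d d' x hd [y' [h hy]]; exists y'; split=> //; lra.
- by move=> d hd; exact: asymptotic_dense.
- move=> e he; exists (e / (2 * growth)); split; first by apply: Rdiv_lt_0_compat; lra.
  move=> x x' [z [h hz]] [z' [h' hz']].
  apply: Rle_lt_trans (asymptotic_inverse_bound _ _ (asymptotic_minus _ _ _ _ h h')) _.
  have -> : e = growth * (2 * (e / (2 * growth))) by field; lra.
  apply: Rmult_lt_compat_l => //; rewrite -/(distance z z').
  have := distance_triangle y z z'; rewrite (distance_sym y); lra.
move=> x hx; exists x; case: (asymptotic_total x) => y0 h0.
suff -> : y = y0 by [].
apply: distance_eq => e he.
have he' : 0 < e / (growth + 1) by apply: Rdiv_lt_0_compat; lra.
case: (hx _ he') => x' [[y' [h' hy']] hx'].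
have := asymptotic_bound _ _ (asymptotic_minus _ _ _ _ h' h0).
rewrite -/(distance y' y0) -/(distance x' x) => hb.
have := distance_triangle y' y y0; rewrite (distance_sym y y') => ht.
have E : e = (growth + 1) * (e / (growth + 1)) by field; lra.
have : growth * distance x' x < growth * (e / (growth + 1)) by apply: Rmult_lt_compat_l.
lra.
Qed.

Theorem scattering_operator : exists W W' : X -> X,
  is_linear W /\ is_linear W' /\
  (forall x, W' (W x) = x) /\ (forall x, W (W' x) = x) /\
  (forall l : X -> X, is_linear l -> (forall r x, l (Q r x) = Q r (l x)) ->
     forall x, W (l x) = l (W x)) /\
  forall w t, evolves w -> 0 <= t ->
    distance (w t) (W (w 0)) <= growth * norm (w 0) * (kappa_oo - kappa t).
Proof.
have [W hW] := functional_choice _ asymptotic_total.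
have [W' hW'] := functional_choice (fun y x => asymptotic x y) asymptotic_surjective.
have Wl l : is_linear l -> (forall r x, l (Q r x) = Q r (l x)) ->
    forall x, W (l x) = l (W x).
  by move=> hl lQ x; apply: asymptotic_unique (hW _) _; exact: asymptotic_map.
have W'W x : W' (W x) = x by apply: asymptotic_injective (hW' _) (hW x).
have WW' x : W (W' x) = x by apply: asymptotic_unique (hW _) (hW' x).
have W_plus x y : W (plus x y) = plus (W x) (W y).
  by apply: asymptotic_unique (hW _) _; exact: asymptotic_plus.
have W_scal c x : W (scal c x) = scal c (W x).
  apply: (Wl (fun x => scal c x)); first exact: (is_linear_scal_r c Rmult_comm).
  by move=> r z; rewrite (linear_scal _ (Q_linear r)).
exists W, W'; split; [split=> //|split; [split|]].
- by exists growth; split; [exact: growth_pos|move=> x; exact: asymptotic_bound].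
- by move=> x y; rewrite -[in LHS](WW' x) -[in LHS](WW' y) -W_plus W'W.
- by move=> c x; rewrite -[in LHS](WW' x) -W_scal W'W.
- exists growth; split; [exact: growth_pos|move=> x].
  exact: asymptotic_inverse_bound.
do 3 (split=> //).
move=> w t hw ht; case: (evolves_converges w hw) => y hy.
have -> : W (w 0) = y by apply: asymptotic_unique (hW _) _; exists w.
exact: evolves_rate.
Qed.

End Evolution.

(** * Orthogonal projection in a Hilbert space *)

Section Scalars.
Context {F : scalar_kind}.
Implicit Types a b : scalars F.

Lemma re_add a b : re (plus a b) = re a + re b.
Proof. by case: F a b. Qed.

Lemma conjugate_plus a b : conjugate (plus a b) = plus (conjugate a) (conjugate b).
Proof. case: F a b => //= a b; exact: Cplus_conj. Qed.

Lemma conjugate_mult a b : conjugate (mult a b) = mult (conjugate a) (conjugate b).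
Proof. case: F a b => //= a b; exact: Cmult_conj. Qed.

Lemma re_conjugate a : re (conjugate a) = re a.
Proof. by case: F a. Qed.

Lemma conjugate_of_real (r : R) : conjugate (of_real r) = of_real r :> scalars F.
Proof. case: F => //=; by rewrite /Cconj /= Ropp_0. Qed.

Lemma re_mult_real (r : R) a : re (mult (of_real r) a) = r * re a.
Proof. case: F a => //= -[x y]; rewrite /mult /= /Re /=; ring. Qed.

Lemma conjugate_self_zero a : re (mult (conjugate a) a) = 0 -> a = zero.
Proof.
case: F a => //=; first by rewrite /mult /zero /=; exact: Rsqr_0_uniq.
move=> [x y]; rewrite /mult /zero /= /Re /= => h.
by have [-> ->] : x = 0 /\ y = 0 by split; nra.
Qed.

Lemma of_real_one : of_real 1 = one :> scalars F.
Proof. by case: F. Qed.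

Lemma of_real_opp_one : of_real (-1) = opp one :> scalars F.
Proof. case: F => //=; rewrite /opp /one /= /Copp /= /RtoC; f_equal; ring. Qed.

Lemma scal_of_real_2 {V : ModuleSpace (scalars F)} (x : V) :
  scal (of_real 2) x = plus x x.
Proof.
have -> : of_real 2 = plus one one :> scalars F.
  case: F => //=; rewrite /plus /one /= /Cplus /= /RtoC; f_equal; ring.
by rewrite scal_distr_r scal_one.
Qed.
End Scalars.

Lemma quadratic_linear_part (n r : R) :
  0 <= n -> (forall t, 0 <= t * t * n + 2 * t * r) -> r = 0.
Proof.
move=> n0 h.
have := h (- r / (n + 1)).
have -> : - r / (n + 1) * (- r / (n + 1)) * n + 2 * (- r / (n + 1)) * r
   = - (r * r) * ((n + 2) / (n + 1) ^ 2) by field; lra.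
have h1 : 0 < (n + 2) / (n + 1) ^ 2 by apply: Rdiv_lt_0_compat; nra.
move=> h2; case: (Req_dec r 0) => // hr.
have : 0 < r * r by nra.
nra.
Qed.

Section Inner.
Context {F : scalar_kind} {H : Hilbert F}.
Implicit Types x y z : H.

Lemma inner_plus_r x y z : inner x (plus y z) = plus (inner x y) (inner x z).
Proof.
have hi := @inner_is_inner F H.
by rewrite (inner_conj _ hi) (inner_plus_l _ hi) conjugate_plus -!(inner_conj _ hi).
Qed.

Lemma inner_scal_r a x y : inner x (scal a y) = mult (conjugate a) (inner x y).
Proof.
have hi := @inner_is_inner F H.
by rewrite (inner_conj _ hi) (inner_scal_l _ hi) conjugate_mult -(inner_conj _ hi).
Qed.

Lemma inner_zero_l y : inner zero y = zero.
Proof.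
by rewrite -(scal_zero_l (zero : H)) (inner_scal_l _ (inner_is_inner _ H)) mult_zero_l.
Qed.

Lemma inner_zero_r y : inner y zero = zero.
Proof.
have := inner_plus_r y zero zero; rewrite plus_zero_l => h.
by apply: (plus_reg_l (inner y zero)); rewrite plus_zero_r -h.
Qed.

Lemma re_inner_minus_r x y z :
  re (inner x (minus y z)) = re (inner x y) - re (inner x z).
Proof.
have := inner_plus_r x (minus y z) z; rewrite plus_minus_cancel => ->.
rewrite re_add; ring.
Qed.

Lemma norm_sq_plus x y (t : R) : norm (plus x (scal (of_real t) y)) ^ 2 =
  norm x ^ 2 + t * t * norm y ^ 2 + 2 * t * re (inner x y).
Proof.
have hi := @inner_is_inner F H.
rewrite !(inner_norm _ hi) (inner_plus_l _ hi) !inner_plus_r !(inner_scal_l _ hi).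
rewrite !inner_scal_r conjugate_of_real !re_add !re_mult_real.
have -> : re (inner y x) = re (inner x y) by rewrite (inner_conj _ hi) re_conjugate.
ring.
Qed.

(** Over complex scalars, replacing [k] by [scal (inner x k) k] turns the
    real part into the square of the modulus. *)
Lemma inner_eq_zero (M : H -> Prop) x :
  (forall a k, M k -> M (scal a k)) -> (forall k, M k -> re (inner x k) = 0) ->
  forall k, M k -> inner x k = zero.
Proof.
move=> Ms h k hk; apply: conjugate_self_zero; rewrite -inner_scal_r.
by apply: h; apply: Ms.
Qed.

Lemma cauchy_schwarz x y : Rabs (re (inner x y)) <= norm x * norm y.
Proof.
have h t : 0 <= norm x ^ 2 + t * t * norm y ^ 2 + 2 * t * re (inner x y).
  by rewrite -norm_sq_plus; exact: pow2_ge_0.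
have nx := norm_ge_0 x; have ny := norm_ge_0 y.
move: h; set r := re _ => h.
have disc : r * r <= norm x ^ 2 * norm y ^ 2.
  case: (Req_dec r 0) => [->|hr]; first nra.
  have r2 : 0 < r * r by nra.
  case: (Req_dec (norm y) 0) => [y0|y0].
    have := h (- (norm x ^ 2 + 1) / (2 * r)); rewrite y0.
    have -> : 2 * (- (norm x ^ 2 + 1) / (2 * r)) * r = - (norm x ^ 2 + 1) by field.
    rewrite pow_i; last exact: Nat.lt_0_succ.
    lra.
  (* The minimum of the quadratic polynomial. *)
  have := h (- r / norm y ^ 2).
  have -> : norm x ^ 2 + - r / norm y ^ 2 * (- r / norm y ^ 2) * norm y ^ 2 +
     2 * (- r / norm y ^ 2) * r = (norm x ^ 2 * norm y ^ 2 - r * r) / norm y ^ 2 by field.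
  have yp : 0 < norm y ^ 2 by apply: pow_lt; lra.
  move=> hd; apply: Rnot_lt_le => hlt.
  have : (norm x ^ 2 * norm y ^ 2 - r * r) / norm y ^ 2 < 0 by apply: Rdiv_neg_pos; lra.
  lra.
apply: Rsqr_incr_0_var; last exact: Rmult_le_pos.
by rewrite -Rsqr_abs /Rsqr; lra.
Qed.

Lemma inner_zero_closed x y :
  (forall eps, 0 < eps -> exists m, re (inner x m) = 0 /\ distance m y < eps) ->
  re (inner x y) = 0.
Proof.
move=> h; suff : Rabs (re (inner x y)) <= 0.
  by case: (Req_dec (re (inner x y)) 0) => // /Rabs_pos_lt; lra.
apply: le_epsilon => e he.
have nx := norm_ge_0 x.
have he' : 0 < e / (norm x + 1) by apply: Rdiv_lt_0_compat; lra.
case: (h _ he') => m [hm hd].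
have -> : re (inner x y) = re (inner x (minus y m)).
  by rewrite -[in LHS](plus_minus_cancel y m) inner_plus_r re_add hm Rplus_0_r.
apply: Rle_trans (cauchy_schwarz _ _) _.
rewrite -/(distance y m) distance_sym.
have E : e = (norm x + 1) * (e / (norm x + 1)) by field; lra.
have : norm x * distance m y <= norm x * (e / (norm x + 1)) by apply: Rmult_le_compat_l; lra.
lra.
Qed.

Lemma parallelogram x y : norm (plus x y) ^ 2 + norm (minus x y) ^ 2 =
  2 * norm x ^ 2 + 2 * norm y ^ 2.
Proof.
have := norm_sq_plus x y 1; have := norm_sq_plus x y (-1).
by rewrite of_real_one of_real_opp_one scal_one scal_opp_one -/(minus x y); lra.
Qed.

Lemma norm_double x : norm (plus x x) = 2 * norm x.
Proof.
have nx := norm_ge_0 x; have np := norm_ge_0 (plus x x).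
have := parallelogram x x; rewrite minus_eq_zero norm_zero.
nra.
Qed.

(** Minimizing vectors are close to each other by the parallelogram identity;
    their limit [m] minimizes the distance, and the first variation of the
    squared distance along [k] is the real part of [inner (x - m) k]. *)
Lemma projection (M : H -> Prop) : M zero ->
  (forall x y, M x -> M y -> M (plus x y)) ->
  (forall a x, M x -> M (scal a x)) ->
  (forall x, (forall eps, 0 < eps -> exists m, M m /\ distance m x < eps) -> M x) ->
  forall x, exists m, M m /\ forall k, M k -> inner (minus x m) k = zero.
Proof.
move=> M0 Mp Ms Mc x.
have [d [d0 [dlb dinf]]] : exists d, 0 <= d /\
    (forall m, M m -> d <= distance x m ^ 2) /\
    (forall e, 0 < e -> exists m, M m /\ distance x m ^ 2 < d + e).
  have [|| l [ub lub]] := completeness (fun r => exists m, M m /\ r = - distance x m ^ 2).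
  - by exists 0 => r [m [_ ->]]; have := pow2_ge_0 (distance x m); lra.
  - by exists (- distance x zero ^ 2), zero.
  exists (- l); split; [|split].
  - have : l <= 0.
      by apply: lub => r [m [_ ->]]; have := pow2_ge_0 (distance x m); lra.
    lra.
  - move=> m hm; have : - distance x m ^ 2 <= l by apply: ub; exists m.
    lra.
  - move=> e he; apply: Classical_Prop.NNPP => hn.
    have : l <= l - e.
      apply: lub => r [m [hm ->]]; apply: Rnot_lt_le => hlt; apply: hn.
      exists m; split=> //; lra.
    lra.
have near m m' : M m -> M m' ->
    distance m m' ^ 2 <= 2 * distance x m ^ 2 + 2 * distance x m' ^ 2 - 4 * d.
  move=> hm hm'.
  pose mid := scal (of_real (1/2)) (plus m m') : H.
  have hmid : M mid by apply: Ms; exact: Mp.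
  have := parallelogram (minus x m') (minus x m).
  have -> : minus (minus x m') (minus x m) = minus m m'.
    by rewrite {1}/minus opp_minus plus_comm -minus_trans.
  have -> : plus (minus x m') (minus x m) = plus (minus x mid) (minus x mid).
    rewrite -!minus_plus_plus; f_equal; rewrite plus_comm -scal_of_real_2 /mid.
    rewrite (real_scal_assoc H) (_ : 2 * (1/2) = 1); last field.
    by rewrite real_scal_one.
  rewrite norm_double -!/(distance _ _).
  have := dlb mid hmid; nra.
case: (complete_approximants (fun e m => M m /\ distance x m ^ 2 < d + e)).
- by move=> e e' m he [hm hd]; split=> //; lra.
- exact: dinf.
- move=> e he; exists (e ^ 2 / 4); split; first by have := pow_lt e 2 he; lra.
  move=> m m' [hm h] [hm' h']; have := near m m' hm hm'.
  have := distance_ge_0 m m'; have := pow_lt e 2 he => h1 h2 h3.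
  nra.
move=> p hp; have Mp' : M p.
  by apply: Mc => e he; case: (hp e he) => m [[hm _] hd]; exists m.
exists p; split=> //.
have hpd : distance x p ^ 2 <= d.
  apply: le_epsilon => e he.
  have hs : 0 < 2 * d + 6 by lra.
  (* [(s + e') ^ 2 <= d + e' + 2 * s * e' + e' ^ 2] with [s <= d + 2] and [e' <= 1]
     exceeds [d] by at most [(2 * d + 6) * e']. *)
  pose e' := Rmin 1 (e / (2 * d + 6)).
  have e'0 : 0 < e' by apply: Rmin_pos; [lra|apply: Rdiv_lt_0_compat].
  have e'1 : e' <= 1 := Rmin_l _ _.
  have e'2 : (2 * d + 6) * e' <= e.
    have -> : e = (2 * d + 6) * (e / (2 * d + 6)) by field; lra.
    apply: Rmult_le_compat_l; [lra|exact: Rmin_r].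
  case: (hp e' e'0) => m [[hm h] hd].
  have := distance_triangle m x p; have := distance_ge_0 x p; have := distance_ge_0 x m.
  have := distance_ge_0 m p.
  set a := distance x p; set s := distance x m in h *; set q := distance m p in hd *.
  move=> q0 s0 a0 ht.
  have s2 : s <= d + 2 by nra.
  have : a ^ 2 <= (s + e') ^ 2 by nra.
  nra.
apply: inner_eq_zero => // k hk.
apply: (quadratic_linear_part (norm k ^ 2)); first exact: pow2_ge_0.
move=> t; have := dlb (minus p (scal (of_real t) k)) _.
rewrite /distance.
have -> : minus x (minus p (scal (of_real t) k)) = plus (minus x p) (scal (of_real t) k).
  by rewrite /minus opp_plus opp_opp plus_assoc.
rewrite norm_sq_plus -/(distance x p) => /(_ _) h.
suff : d <= distance x p ^ 2 + t * t * norm k ^ 2 + 2 * t * re (inner (minus x p) k) by lra.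
apply: h; rewrite /minus -scal_opp_l; apply: Mp => //; exact: Ms.
Qed.
End Inner.

(** * Kernel and range of a self-adjoint operator *)

Lemma linear_real_form {F : scalar_kind} {U V : NormedModule (scalars F)} (l : U -> V) :
  is_linear l -> @is_linear R_AbsRing (real_form U) (real_form V) l.
Proof.
move=> h; split; first exact: (linear_plus _ h).
- move=> r x; exact: (linear_scal _ h).
- exact: (linear_norm _ h).
Qed.

Definition complete_real_form {F : scalar_kind} (V : CompleteNormedModule (scalars F)) :
    CompleteNormedModule R_AbsRing :=
  CompleteNormedModule.Pack R_AbsRing V
    (CompleteNormedModule.Class R_AbsRing V (NormedModule.class R_AbsRing (real_form V))
      (CompleteSpace.class V)) V.

Section SelfAdjoint.
Context {F : scalar_kind} {H : Hilbert F} (L : operator H).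
Hypothesis L_selfadjoint : selfadjoint L.

Definition kernel (n : H) : Prop := dom L n /\ L n = zero.

Lemma inner_range_kernel x n : dom L x -> kernel n -> inner (L x) n = zero.
Proof.
move=> hx [hn Ln]; case: L_selfadjoint => _ /(_ n (L n)) [_ h].
by rewrite (h (conj hn eq_refl)) // Ln inner_zero_r.
Qed.

(** Such an [n] belongs to the domain of the adjoint, which is [L]; the real part
    is enough because the domain is closed under multiplication by scalars. *)
Lemma kernel_intro n : (forall x, dom L x -> re (inner (L x) n) = 0) -> kernel n.
Proof.
move=> h; case: L_selfadjoint => _ /(_ n zero) [hn _].
have [] : dom L n /\ zero = L n; last by split.
apply: hn => x hx; rewrite inner_zero_r; apply: conjugate_self_zero.
rewrite -(inner_scal_l _ (inner_is_inner F H)) -app_scal //; apply: h.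
exact: dom_scal.
Qed.

Lemma closed_kernel x :
  (forall eps, 0 < eps -> exists m, kernel m /\ distance m x < eps) -> kernel x.
Proof.
move=> h; apply: kernel_intro => y hy; apply: inner_zero_closed => e he.
case: (h e he) => m [hm hd]; exists m; split=> //.
by rewrite inner_range_kernel //; case: F.
Qed.

(** Vectors of the energy space have their first component in the complement
    of the kernel; this costs nothing in the range of [L]. *)
Lemma kernel_complement x : dom L x ->
  exists y, dom L y /\ L y = L x /\ forall n, kernel n -> inner y n = zero.
Proof.
move=> hx; case: (projection kernel _ _ _ closed_kernel x).
- by split; [exact: dom_zero|rewrite -{1}(scal_zero_l zero) app_scal ?scal_zero_l //; exact: dom_zero].
- move=> y z [hy Ly] [hz Lz]; split; first exact: dom_plus.
  by rewrite app_plus // Ly Lz plus_zero_l.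
- move=> a y [hy Ly]; split; first exact: dom_scal.
  by rewrite app_scal // Ly scal_zero_r.
move=> m [[hm Lm] hk]; have hm' : dom L (opp m) by rewrite -scal_opp_one; exact: dom_scal.
exists (minus x m); split; first exact: dom_plus.
split=> //; rewrite /minus app_plus // -scal_opp_one app_scal // Lm scal_zero_r.
exact: plus_zero_r.
Qed.

(** The component of [x] orthogonal to the range of [L] lies in the kernel, by
    self-adjointness, and there it is orthogonal to itself. *)
Lemma range_dense x : (forall n, kernel n -> re (inner n x) = 0) ->
  forall eps, 0 < eps -> exists y, dom L y /\ distance (L y) x < eps.
Proof.
move=> hx.
pose M z := forall eps, 0 < eps -> exists y, dom L y /\ distance (L y) z < eps.
have L0 : L zero = zero.
  by rewrite -{1}(scal_zero_l zero) app_scal ?scal_zero_l //; exact: dom_zero.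
case: (projection M _ _ _ _ x).
- move=> e he; exists zero; split; first exact: dom_zero.
  by rewrite L0 distance_diag.
- move=> y z hy hz e he; have he2 : 0 < e / 2 by lra.
  case: (hy _ he2) => y' [dy hy']; case: (hz _ he2) => z' [dz hz'].
  exists (plus y' z'); split; first exact: dom_plus.
  rewrite app_plus // /distance minus_plus_plus.
  apply: Rle_lt_trans (norm_triangle _ _) _; rewrite -!/(distance _ _); lra.
- move=> a y hy e he; have ha := abs_ge_0 a.
  have he' : 0 < e / (abs a + 1) by apply: Rdiv_lt_0_compat; lra.
  case: (hy _ he') => y' [dy hy']; exists (scal a y'); split; first exact: dom_scal.
  rewrite app_scal // /distance -scal_minus_distr_l.
  apply: Rle_lt_trans (norm_scal _ _) _; rewrite -/(distance _ _).
  have E : e = (abs a + 1) * (e / (abs a + 1)) by field; lra.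
  have : abs a * distance (L y') y <= abs a * (e / (abs a + 1)).
    by apply: Rmult_le_compat_l; lra.
  lra.
- move=> y hy e he; have he2 : 0 < e / 2 by lra.
  case: (hy _ he2) => m [hm hd]; case: (hm _ he2) => z [dz hz].
  exists z; split=> //; have := distance_triangle m (L z) y; lra.
move=> m [hm hk].
have hker : kernel (minus x m).
  apply: kernel_intro => y hy.
  have hM : M (L y) by move=> e he; exists y; rewrite distance_diag.
  rewrite (inner_conj _ (inner_is_inner F H)) re_conjugate (hk _ hM); by case: F.
suff -> : x = m by [].
apply: distance_eq => e he.
suff : distance x m ^ 2 = 0 by have := distance_ge_0 x m; nra.
rewrite /distance (inner_norm _ (inner_is_inner F H)).
rewrite re_inner_minus_r hx //.
suff -> : re (inner (minus x m) m) = 0 by exact: Rminus_diag.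
apply: inner_zero_closed => d hd; case: (hm d hd) => y [dy hy].
exists (L y); split=> //.
rewrite (inner_conj _ (inner_is_inner F H)) re_conjugate inner_range_kernel //; by case: F.
Qed.

End SelfAdjoint.

(** * Unitary groups *)

Lemma norm_sq_pair {F : scalar_kind} {H : Hilbert F} (z : square H) :
  norm z ^ 2 = norm (fst z) ^ 2 + norm (snd z) ^ 2.
Proof.
have -> : norm z = sqrt (norm (fst z) ^ 2 + norm (snd z) ^ 2) by [].
by apply: pow2_sqrt; apply: Rplus_le_le_0_compat; exact: pow2_ge_0.
Qed.

Section Group.
Context {F : scalar_kind} {H : Hilbert F} (G : R -> square H -> square H).
Hypothesis G_unitary : unitary_group G.

Lemma group_norm t x : norm (G t x) = norm x.
Proof.
have sq (z : square H) : norm z ^ 2 = re (inner2 z z) :> R.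
  rewrite norm_sq_pair /inner2 re_add.
  by rewrite !(inner_norm _ (inner_is_inner F H)).
have := sq (G t x); rewrite (group_inner _ G_unitary) -sq => h.
by have := norm_ge_0 (G t x); have := norm_ge_0 x; nra.
Qed.

Lemma group_linear t : is_linear (G t).
Proof.
split; [exact: group_plus|by move=> k x; exact: group_scal|].
by exists 1; split; [lra|move=> x; rewrite group_norm; lra].
Qed.

Lemma group_inverse t x : G (- t) (G t x) = x.
Proof. by rewrite -(group_add _ G_unitary) Rplus_opp_l (group_zero _ G_unitary). Qed.

(** The orbit of [x] has derivative zero: at time [t] it is the image under
    [G t] of the derivative at [0]. *)
Lemma group_fixes_kernel (B : operator (square H)) x :
  generates B G -> dom B x -> B x = zero -> forall t, G t x = x.
Proof.
move=> gen dx Bx.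
have [_ /(_ (conj dx (eq_sym Bx)))] := gen x zero.
move=> /filterlim_locally_ball_norm hlim.
have small e : 0 < e -> locally 0 (fun h => norm (minus (G h x) x) <= e * Rabs h).
  move=> he; have := hlim (mkposreal e he); rewrite /locally' /within.
  apply: filter_imp => h hh.
  case: (Req_dec h 0) => [->|h0].
    by rewrite (group_zero _ G_unitary) minus_eq_zero norm_zero Rabs_R0; lra.
  have {}hh : norm (scal (of_real (/ h)) (minus (G h x) x)) < e.
    by have := hh h0; rewrite /ball_norm minus_zero_r.
  have E1 : minus (G h x) x = scal (of_real h) (scal (of_real (/ h)) (minus (G h x) x)).
    rewrite (real_scal_assoc (square H)) Rinv_r //.
    by rewrite (real_scal_one (square H)).
  rewrite E1; apply: Rle_trans (real_norm_scal (square H) _ _) _.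
  rewrite Rmult_comm; apply: Rmult_le_compat_r; [exact: Rabs_pos|exact: Rlt_le].
have der t : @is_derive R_AbsRing (real_form (square H)) (fun s => G s x) t zero.
  split; first exact: (@is_linear_scal_l R_AbsRing (real_form (square H))).
  move=> y hy e.
  have <- : t = y by exact: (@is_filter_lim_locally_unique _ R_NormedModule).
  have hs := small e (cond_pos e).
  have hc : filterlim (fun s => s - t) (locally t) (locally 0).
    have := (@continuous_minus _ _ R_NormedModule id (fun _ => t) t (continuous_id _) (continuous_const _ _)).
    by rewrite /continuous /minus /plus /opp /= Rplus_opp_r.
  have := hc _ hs; rewrite /filtermap; apply: filter_imp => s hst.
  rewrite scal_zero_r minus_zero_r.
  have -> : minus (G s x) (G t x) = G t (minus (G (s - t) x) x).
    rewrite linear_minus; last exact: group_linear.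
    rewrite -(group_add _ G_unitary); do 2 f_equal; ring.
  have -> : @norm _ (real_form (square H)) (G t (minus (G (s - t) x) x)) =
     norm (G t (minus (G (s - t) x) x)) by [].
  by rewrite group_norm.
have const a b : a < b -> G a x = G b x.
  by apply: (@eq_is_derive (real_form (square H)) (fun s => G s x)) => t _.
move=> t; rewrite -[RHS](group_zero _ G_unitary).
case: (Rtotal_order t 0) => [|[->|]] // h; first exact: const.
by symmetry; apply: const.
Qed.
End Group.

(** * The energy space *)

Section Energy.
Context {F : scalar_kind} {H : Hilbert F} (L : operator H).
Context (E : CompleteNormedModule (scalars F)) (i : square H -> E) (J : E -> square H).
Hypothesis L_selfadjoint : selfadjoint L.
Hypothesis E_energy : is_energy_space L E i.
Hypothesis J_energy : is_energy_map L i J.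

Lemma energy_map_norm e : norm (J e) = norm e.
Proof.
case: J_energy => Jlin Ji; case: (linear_norm _ Jlin) => M [M0 hM].
suff : Rabs (norm (J e) - norm e) <= 0.
  by move=> h; case: (Req_dec (norm (J e) - norm e) 0) => [|/Rabs_pos_lt]; lra.
apply: le_epsilon => d hd.
have hd' : 0 < d / (M + 1) by apply: Rdiv_lt_0_compat; lra.
case: (energy_dense _ _ _ E_energy e (mkposreal _ hd')) => _ [[u [hu ->]] /= he].
have {}he : distance e (i u) < d / (M + 1) := he.
have hJ : distance (J e) (J (i u)) <= M * distance e (i u).
  by rewrite /distance -linear_minus.
have h1 : Rabs (norm e - norm (i u)) <= distance e (i u) := norm_triangle_inv e (i u).
have h2 : Rabs (norm (J e) - norm (i u)) <= distance (J e) (J (i u)).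
  by rewrite {1}(energy_norm _ _ _ E_energy) // -Ji //; exact: norm_triangle_inv.
have E1 : d = (M + 1) * (d / (M + 1)) by field; lra.
have : M * distance e (i u) <= M * (d / (M + 1)) by apply: Rmult_le_compat_l; lra.
move: h1 h2 => /Rabs_le_between h1 /Rabs_le_between h2 h3.
rewrite Rplus_0_l; apply/Rabs_le_between; split; lra.
Qed.

Lemma energy_map_distance e e' : distance (J e) (J e') = distance e e'.
Proof. by rewrite /distance -linear_minus ?energy_map_norm //; case: J_energy. Qed.

Lemma energy_map_injective e e' : J e = J e' -> e = e'.
Proof.
move=> h; apply: distance_eq => d hd.
by rewrite -energy_map_distance h distance_diag.
Qed.

(** The image of [J]. Only real parts are required, since this real condition
    is what passes to limits and to the group; the kernel being closed
    under multiplication by scalars, it amounts to full orthogonality. *)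
Definition orthogonal_to_kernel (z : square H) : Prop :=
  forall n, kernel L n -> re (inner n (fst z)) = 0.

Lemma pair_distance (x y v : H) :
  distance ((x, v) : square H) (y, v) = distance x y.
Proof.
have h := norm_sq_pair (minus ((x, v) : square H) (y, v)).
have E1 : snd (minus ((x, v) : square H) (y, v)) = zero by exact: (minus_eq_zero v).
rewrite E1 norm_zero in h.
apply: Rsqr_inj; [exact: distance_ge_0|exact: distance_ge_0|].
by rewrite !Rsqr_pow2 /distance h; ring_simplify.
Qed.

Lemma distance_fst (x y : square H) : distance (fst x) (fst y) <= distance x y.
Proof.
exact: Rle_trans (Rmax_l _ _) (proj1 (norm_prod (minus (fst x) (fst y)) (minus (snd x) (snd y)))).
Qed.

Lemma energy_range_intro z : orthogonal_to_kernel z -> exists e, J e = z.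
Proof.
move=> hz; case: J_energy => Jlin Ji.
case: (complete_approximants (fun d e => distance (J e) z < d)).
- by move=> d d' e; lra.
- move=> d hd; case: (range_dense L L_selfadjoint (fst z) hz d hd) => x [dx hx].
  case: (kernel_complement L L_selfadjoint x dx) => y [dy [Ly hy]].
  exists (i (y, snd z)); rewrite Ji; last by split=> // w dw Lw; exact: hy.
  by case: z hz hx => z1 z2 /= _; rewrite pair_distance Ly.
- move=> d hd; exists (d / 2); split; first lra.
  move=> e e' h h'; rewrite -energy_map_distance.
  apply: Rle_lt_trans (distance_triangle z _ _) _; rewrite (_ : d = d / 2 + d / 2); last field.
  by apply: Rplus_lt_compat => //; rewrite distance_sym.
move=> e he; exists e; apply: distance_eq => d hd.
have hd2 : 0 < d / 2 by lra.
case: (he _ hd2) => e' [h1 h2]; rewrite -energy_map_distance in h2.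
apply: Rle_lt_trans (distance_triangle (J e') _ _) _.
rewrite (_ : d = d / 2 + d / 2); last field.
by apply: Rplus_lt_compat => //; rewrite distance_sym.
Qed.

Lemma energy_range e : orthogonal_to_kernel (J e).
Proof.
case: J_energy => Jlin Ji n hn; apply: inner_zero_closed => d hd.
case: (energy_dense _ _ _ E_energy e (mkposreal _ hd)) => _ [[u [[du hu] ->]] /= he].
exists (L (fst u)); split.
  rewrite (inner_conj _ (inner_is_inner F H)) re_conjugate.
  by rewrite inner_range_kernel //; case: F.
have {}he : distance (J (i u)) (J e) < d by rewrite energy_map_distance distance_sym.
rewrite Ji // in he; apply: Rle_lt_trans he.
exact: (distance_fst (L (fst u), snd u) (J e)).
Qed.

(** An operator of the product space that preserves the image of [J] acts on
    the energy space. *)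
Lemma energy_lift {T : Type} (f : T -> square H -> square H) :
  (forall t, is_linear (f t)) ->
  (forall t z, orthogonal_to_kernel z -> orthogonal_to_kernel (f t z)) ->
  exists g : T -> E -> E, (forall t, is_linear (g t)) /\ forall t e, J (g t e) = f t (J e).
Proof.
move=> flin forth; case: J_energy => Jlin _.
case: (functional_choice (fun (p : T * E) e => J e = f (fst p) (J (snd p)))).
  by move=> [t e]; apply: energy_range_intro; apply: forth; exact: energy_range.
move=> g hg; exists (fun t e => g (t, e)); split=> [t|t e]; last exact: hg.
split.
- move=> x y; apply: energy_map_injective.
  rewrite hg !(linear_plus _ Jlin) !hg; exact: (linear_plus _ (flin t)).
- move=> k x; apply: energy_map_injective.
  rewrite hg !(linear_scal _ Jlin) !hg; exact: (linear_scal _ (flin t)).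
- case: (linear_norm _ (flin t)) => M [M0 hM]; exists M; split=> // x.
  by rewrite -energy_map_norm hg -(energy_map_norm x); exact: hM.
Qed.

Definition velocity_part (z : square H) : square H := (zero, snd z).

Lemma velocity_part_linear : is_linear velocity_part.
Proof. apply: is_linear_prod; [exact: is_linear_zero|exact: is_linear_snd]. Qed.

Lemma norm_velocity_part z : norm (velocity_part z) <= norm z.
Proof.
have := norm_sq_pair z; have := norm_sq_pair (velocity_part z); rewrite /= norm_zero.
have := norm_ge_0 z; have := norm_ge_0 (velocity_part z); have := pow2_ge_0 (norm (fst z)).
have := pow2_ge_0 (norm (snd z)).
nra.
Qed.

Lemma velocity_part_orthogonal z : orthogonal_to_kernel (velocity_part z).
Proof. by move=> n hn; rewrite inner_zero_r; case: F. Qed.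

Context (E0 : R -> square H -> square H).
Hypothesis E0_unitary : unitary_group E0.
Hypothesis E0_generator : generates (wave_operator L) E0.

(** The vectors [(n, 0)] with [n] in the kernel are annihilated by the
    generator, hence fixed, and the group preserves inner products. *)
Lemma group_orthogonal t z : orthogonal_to_kernel z -> orthogonal_to_kernel (E0 t z).
Proof.
move=> hz n hn; case: (hn) => dn Ln.
pose N : square H := (n, zero).
have L0 : L zero = zero.
  by rewrite -{1}(scal_zero_l zero) app_scal ?scal_zero_l //; exact: dom_zero.
have fixN : E0 t N = N.
  apply: (group_fixes_kernel E0 E0_unitary (wave_operator L)) => //.
    by split=> //; exact: dom_zero.
  by rewrite /= /wave_app /= L0 Ln opp_zero.
have inN z' : re (inner2 N z') = re (inner n (fst z')).
  by rewrite /inner2 /= inner_zero_l plus_zero_r.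
by rewrite -inN -fixN (group_inner _ E0_unitary) inN hz.
Qed.

End Energy.

(** * The integrated damping *)

Lemma continuous_on_C1 b : C1_half_line b -> continuous_on (fun t => 0 <= t) b.
Proof.
move=> [b' [hb _]] t ht.
apply: (@filterdiff_continuous_aux _ R_NormedModule R_NormedModule).
  by eexists; apply: hb.
by move=> P hP; apply: filter_imp hP.
Qed.

(** Reflection in the origin extends curves on the half-line continuously to
    the line, on which the evolution equation is posed. *)
Lemma continuous_comp_abs {V : UniformSpace} (f : R -> V) t :
  continuous_on (fun s => 0 <= s) f -> continuous (fun s => f (Rabs s)) t.
Proof.
move=> hf P hP; have := hf (Rabs t) (Rabs_pos t) P hP.
rewrite /filtermap /within => h.
have := continuous_Rabs t _ h; rewrite /filtermap.
by apply: filter_imp => s; apply; exact: Rabs_pos.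
Qed.

Section Damping.
Variables (b : R -> R) (l : R).
Hypothesis b_pos : forall t, 0 <= t -> 0 < b t.
Hypothesis b_cont : continuous_on (fun t => 0 <= t) b.
Hypothesis b_integral : is_RInt_gen b (at_point 0) (Rbar_locally p_infty) l.

Definition rate (t : R) : R := 2 * b (Rabs t).
Definition damping (t : R) : R := RInt rate 0 t.

Lemma rate_continuous t : continuous rate t.
Proof.
apply: (@continuous_scal_r _ R_AbsRing R_NormedModule 2 (fun t => b (Rabs t))).
exact: continuous_comp_abs.
Qed.

Lemma rate_ge0 t : 0 <= rate t.
Proof. by have := b_pos _ (Rabs_pos t); rewrite /rate; lra. Qed.

Lemma is_RInt_rate t : is_RInt rate 0 t (damping t).
Proof. exact: (@ex_RInt_cont R_CompleteNormedModule _ _ _ rate_continuous). Qed.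

Lemma damping_derive t : is_derive damping t (rate t).
Proof. exact: (@is_derive_RInt_cont R_CompleteNormedModule _ _ _ rate_continuous). Qed.

Lemma is_RInt_damping t : 0 <= t -> is_RInt b 0 t (damping t / 2).
Proof.
move=> ht; have -> : damping t / 2 = scal (1/2) (damping t).
  by rewrite /scal /= /mult /=; field.
apply: is_RInt_ext (is_RInt_scal _ _ _ (1/2) _ (is_RInt_rate t)) => r [h0 _].
rewrite Rmin_left // in h0.
by rewrite /scal /= /mult /= /rate Rabs_pos_eq; [field|lra].
Qed.

Lemma damping_lim : filterlim damping (Rbar_locally p_infty) (locally (2 * l)).
Proof.
apply/filterlim_locally => -[e he].
have he2 : 0 < e / 2 by lra.
have := b_integral _ (locally_ball l (mkposreal _ he2)).
case=> Q S hQ [M hM] h.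
exists (Rmax M 0) => t ht.
have hMt : M < t by apply: Rle_lt_trans ht; exact: Rmax_l.
have h0t : 0 <= t by apply: Rlt_le; apply: Rle_lt_trans ht; exact: Rmax_r.
case: (h 0 t hQ (hM t hMt)) => y [hy].
have -> : y = damping t / 2 := filterlim_locally_unique (V := R_NormedModule) _ _ _ hy (is_RInt_damping t h0t).
rewrite /ball /= /AbsRing_ball /abs /minus /plus /opp /= => hb.
have -> : damping t + - (2 * l) = 2 * (damping t / 2 + - l) by field.
rewrite Rabs_mult Rabs_pos_eq; lra.
Qed.

Lemma tail_integralE t : 0 <= t -> tail_integral b t = l - damping t / 2.
Proof.
move=> ht.
apply: (@is_RInt_gen_unique R_CompleteNormedModule (at_point t) (Rbar_locally p_infty)
  (Proper_StrongProper _ (at_point_filter t)) (Proper_StrongProper _ (Rbar_locally_filter p_infty))).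
have h := proj2 (is_RInt_gen_at_point b t 0 _) (is_RInt_swap _ _ _ _ (is_RInt_damping t ht)).
have -> : l - damping t / 2 = plus (opp (damping t / 2)) l.
  by rewrite /plus /opp /=; ring.
exact: is_RInt_gen_Chasles h b_integral.
Qed.

Lemma damping_opp t : damping (- t) = - damping t.
Proof.
have h := is_RInt_rate (- t); rewrite -{1}Ropp_0 in h.
have {}h := is_RInt_comp_opp _ _ _ _ h.
have h' := is_RInt_opp _ _ _ _ (is_RInt_rate t).
apply: (filterlim_locally_unique (V := R_NormedModule) _ _ _ h).
by apply: is_RInt_ext h' => r _; rewrite /rate Rabs_Ropp.
Qed.

Lemma damping_bound t : Rabs (damping t) <= 2 * l.
Proof.
have h s : 0 <= s -> 0 <= damping s <= 2 * l.
  move=> hs; split.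
    have <- : damping 0 = 0 by rewrite /damping RInt_point.
    exact: (kappa_le rate damping rate_ge0 damping_derive).
  exact: (kappa_le_lim rate damping rate_ge0 damping_derive _ damping_lim).
case: (Rle_dec 0 t) => ht.
  have hd := h t ht; rewrite Rabs_pos_eq; lra.
have ht' : 0 <= - t by lra.
have hd := h _ ht'; rewrite damping_opp in hd; rewrite -Rabs_Ropp Rabs_pos_eq; lra.
Qed.

Lemma tail_integral_lim c : is_lim (fun t => c * tail_integral b t) p_infty 0.
Proof.
apply: (is_lim_ext_loc (fun t => c * (l - damping t / 2))).
  by exists 0 => t ht; rewrite tail_integralE //; exact: Rlt_le.
have -> : Finite 0 = Finite (c * (l - 2 * l / 2)) by f_equal; field.
apply: (filterlim_comp _ _ _ damping (fun x => c * (l - x / 2)) _ _ _ damping_lim).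
by apply: (ex_derive_continuous (V := R_NormedModule)); auto_derive.
Qed.
End Damping.

(** * Scattering in the energy space *)

(** [T] and [P] stand for the free group and the velocity projection,
    transported to [E] by [J]. *)
Section Scattering.
Context {F : scalar_kind} {H : Hilbert F} (L : operator H).
Context (E : CompleteNormedModule (scalars F)) (i : square H -> E) (J : E -> square H).
Hypothesis E_energy : is_energy_space L E i.
Hypothesis J_energy : is_energy_map L i J.
Context (G : R -> square H -> square H).
Hypothesis G_unitary : unitary_group G.

Context (T : R -> E -> E) (P : E -> E).
Hypothesis T_linear : forall t, is_linear (T t).
Hypothesis P_linear : is_linear P.
Hypothesis J_T : forall t e, J (T t e) = G t (J e).
Hypothesis J_P : forall e, J (P e) = velocity_part (J e).

Lemma J_linear : is_linear J.
Proof. by case: J_energy. Qed.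

Lemma T_norm t e : norm (T t e) = norm e.
Proof.
rewrite -!(energy_map_norm L E i J E_energy J_energy) J_T.
exact: group_norm.
Qed.

Lemma T_inverse t e : T (- t) (T t e) = e.
Proof.
apply: (energy_map_injective L E i J E_energy J_energy).
by rewrite !J_T group_inverse.
Qed.

Lemma T_continuous e t : continuous (fun s => T s e) t.
Proof.
apply/continuous_distance => d hd.
have /continuous_distance /(_ d hd) := group_continuous _ G_unitary (J e) t.
apply: filter_imp => s; rewrite -!J_T.
by rewrite (energy_map_distance L E i J E_energy J_energy).
Qed.

Lemma P_norm e : norm (P e) <= norm e.
Proof.
rewrite -!(energy_map_norm L E i J E_energy J_energy) J_P.
exact: norm_velocity_part.
Qed.

(** The damping seen in the interaction picture. *)
Definition absorption (r : R) (e : E) : E := opp (T (- r) (P (T r e))).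

Lemma absorption_linear r : is_linear (absorption r).
Proof.
apply: (is_linear_comp (fun e => T (- r) (P (T r e))) opp); last exact: is_linear_opp.
apply: (is_linear_comp (fun e => P (T r e)) (T (- r))) => //.
exact: (is_linear_comp (T r) P).
Qed.

Lemma absorption_norm r e : norm (absorption r e) <= norm e.
Proof.
rewrite /absorption norm_opp T_norm; apply: Rle_trans (P_norm _) _.
rewrite T_norm; exact: Rle_refl.
Qed.

Lemma T_opp_continuous e t : continuous (fun s => T (- s) e) t.
Proof.
apply: (continuous_comp (fun s => - s) (fun s => T s e)); last exact: T_continuous.
exact: (@continuous_opp _ _ R_NormedModule id t (continuous_id t)).
Qed.

Lemma absorption_continuous e r : continuous (fun s => absorption s e) r.
Proof.
apply: (continuous_opp (V := E)).
apply: (continuous_apply (fun s => T (- s)) (fun s => P (T s e))) => //.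
- by move=> s x; rewrite T_norm; exact: Rle_refl.
- by move=> x; exact: T_opp_continuous.
- apply: (continuous_comp (fun s => T s e) P); first exact: T_continuous.
  exact: linear_cont.
Qed.

Section Solutions.
Variable b : R -> R.
Hypothesis b_cont : continuous_on (fun t => 0 <= t) b.

(** The integral equation for [u], pulled back by the free group. The integral
    of the pulled back equation exists in [E] by continuity; mapped by [J] it
    is the integral in the product space, which gives the equation in [E]. *)
Lemma damped_evolves (u0 : E) (u : R -> E) :
  energy_solution J G b u0 u ->
  exists w : R -> complete_real_form E,
    evolves (X := complete_real_form E) absorption (rate b) w /\ w 0 = u0 /\
    forall t, 0 <= t -> w t = T (- t) (u t).
Proof.
move=> [cJu hu].
have Jreal := linear_real_form J J_linear.
have cu : continuous_on (fun t => 0 <= t) u.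
  move=> t ht; apply/filterlim_locally_ball_norm => d.
  have /filterlim_locally_ball_norm /(_ d) := cJu t ht.
  apply: filter_imp => s; rewrite /ball_norm -!/(distance _ _).
  by rewrite (energy_map_distance L E i J E_energy J_energy).
pose w (t : R) : complete_real_form E := T (- Rabs t) (u (Rabs t)).
have wE t : 0 <= t -> w t = T (- t) (u t) by move=> ht; rewrite /w Rabs_pos_eq.
have cw t : continuous w t.
  apply: (continuous_apply (fun s => T (- Rabs s)) (fun s => u (Rabs s))) => //.
  - by move=> s x; rewrite T_norm; exact: Rle_refl.
  - move=> x; apply: (continuous_comp Rabs (fun s => T (- s) x)); last exact: T_opp_continuous.
    exact: continuous_Rabs.
  - exact: continuous_comp_abs.
have cfield : forall t, continuous (vector_field (X := complete_real_form E) absorption (rate b) w) t.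
  apply: vector_field_continuous => //.
  - by move=> r; apply: linear_real_form; exact: absorption_linear.
  - exact: absorption_norm.
  - exact: absorption_continuous.
  - exact: rate_continuous.
have key t : 0 <= t ->
    is_RInt (vector_field (X := complete_real_form E) absorption (rate b) w) 0 t (minus (w t) u0).
  move=> ht; have hI := ex_RInt_cont _ 0 t cfield.
  suff -> : minus (w t) u0 = RInt (vector_field (X := complete_real_form E) absorption (rate b) w) 0 t by [].
  apply: (energy_map_injective L E i J E_energy J_energy).
  have hJI := is_RInt_linear (U := complete_real_form E) (V := real_form (square H)) J _ _ _ _ Jreal hI.
  case: (hu t ht) => I [hint hJu].
  have lin : is_linear (fun z => opp (G (- t) z)).
    apply: (is_linear_comp (G (- t)) opp); [exact: group_linear|exact: is_linear_opp].
  have hGI := is_RInt_linear (U := real_form (square H)) (V := real_form (square H)) _ _ _ _ _ (linear_real_form _ lin) hint.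
  have <- : opp (G (- t) I) = J (RInt (vector_field (X := complete_real_form E) absorption (rate b) w) 0 t).
    apply: (filterlim_locally_unique (V := real_form (square H)) _ _ _ _ hJI).
    apply: is_RInt_ext hGI => r [hr _]; rewrite Rmin_left // in hr.
    have r0 := Rlt_le _ _ hr.
    have -> : vector_field (X := complete_real_form E) absorption (rate b) w r =
        scal (of_real (2 * b r)) (opp (T (- r) (P (u r)))) :> E.
      rewrite /vector_field /absorption wE //.
      have -> : T r (T (- r) (u r)) = u r.
        by have := T_inverse (- r) (u r); rewrite Ropp_involutive.
      by rewrite /rate Rabs_pos_eq.
    rewrite (linear_scal _ J_linear) (linear_opp _ _ J_linear) J_T J_P.
    rewrite -(group_add _ G_unitary) (_ : - t + (t - r) = - r); last ring.
    have -> : (zero, scal (of_real (2 * b r)) (snd (J (u r)))) =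
        scal (of_real (2 * b r)) (velocity_part (J (u r))) :> square H.
      by apply: injective_projections => //=; rewrite scal_zero_r.
    rewrite (group_scal _ G_unitary); symmetry; exact: scal_opp_r.
  rewrite linear_minus; last exact: J_linear.
  rewrite wE // J_T hJu linear_minus; last exact: group_linear.
  rewrite group_inverse // /minus -plus_assoc (plus_comm (opp (G (- t) I))).
  by rewrite plus_assoc plus_opp_r plus_zero_l.
have w0 : w 0 = u0.
  rewrite -[LHS](plus_minus_cancel (w 0) u0).
  have <- := filterlim_locally_unique (V := complete_real_form E) _ _ _
    (is_RInt_point (V := complete_real_form E) _ 0) (key 0 (Rle_refl 0)).
  exact: plus_zero_l.
exists w; split; [split=> // t ht|by split].
by rewrite w0; exact: key.
Qed.

Lemma free_solution (e : E) (v : R -> E) t :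
  energy_solution J G (fun _ => 0) e v -> 0 <= t -> v t = T t e.
Proof.
move=> [_ hv] ht; apply: (energy_map_injective L E i J E_energy J_energy).
case: (hv t ht) => I [hI ->]; rewrite J_T.
suff -> : I = zero by exact: minus_zero_r.
have h0 := is_RInt_const (V := real_form (square H)) 0 t zero.
rewrite scal_zero_r in h0.
apply: (filterlim_locally_unique (V := real_form (square H)) _ _ _ hI).
apply: is_RInt_ext h0 => r _.
have -> : (zero, scal (of_real (2 * 0)) (snd (J (v r)))) = zero :> square H.
  apply: injective_projections => //=.
  rewrite Rmult_0_r (_ : of_real 0 = zero) ?scal_zero_l //.
  by case: F.
symmetry; exact: (linear_zero (G (t - r)) (group_linear G G_unitary _)).
Qed.

End Solutions.
End Scattering.

Lemma is_linear_scal_scalars {F : scalar_kind} {V : NormedModule (scalars F)} (a : scalars F) :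
  is_linear (fun x : V => scal a x).
Proof.
apply: is_linear_scal_r => x y; case: F V a x y => V a x y; [exact: Rmult_comm|exact: Cmult_comm].
Qed.

Theorem theorem1p1 (F : scalar_kind) (H : Hilbert F) (A Lambda : operator H)
  (E0 : R -> square H -> square H)
  (E : CompleteNormedModule (scalars F)) (i : square H -> E) (J : E -> square H)
  (b : R -> R)
  (H_separable : separable H)
  (A_closed : closed_operator A)
  (A_selfadjoint : selfadjoint A)
  (A_nonnegative : nonnegative A)
  (Lambda_sqrt : is_sqrt_of Lambda A)
  (E0_unitary : unitary_group E0)
  (E0_generator : generates (wave_operator Lambda) E0)
  (E_energy : is_energy_space Lambda E i)
  (J_energy : is_energy_map Lambda i J)
  (b_pos : forall t, 0 <= t -> 0 < b t)
  (b_C1 : C1_half_line b)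
  (b_L1 : ex_RInt_gen b (at_point 0) (Rbar_locally p_infty)) :
  exists (W : E -> E) (C : R),
    invertible W /\ 0 < C /\
    forall u0 : E,
      (forall u v : R -> E,
         energy_solution J E0 b u0 u ->
         energy_solution J E0 (fun _ => 0) (W u0) v ->
         forall t, 0 <= t ->
           norm (minus (u t) (v t)) <= C * norm u0 * tail_integral b t) /\
      is_lim (fun t => C * norm u0 * tail_integral b t) p_infty 0.
Proof.
have L_selfadjoint : selfadjoint Lambda by case: Lambda_sqrt.
have b_cont := continuous_on_C1 b b_C1.
case: b_L1 => l b_int.
have [T [T_linear J_T]] := energy_lift Lambda E i J L_selfadjoint E_energy J_energy E0
  (group_linear E0 E0_unitary)
  (fun t z => group_orthogonal Lambda E0 E0_unitary E0_generator t z).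
have [P0 [P_linear J_P]] := energy_lift Lambda E i J L_selfadjoint E_energy J_energy
  (fun _ : unit => velocity_part) (fun _ => velocity_part_linear)
  (fun _ z _ => velocity_part_orthogonal Lambda z).
pose P := P0 tt.
pose Q := absorption E T P.
have Q_linear := absorption_linear E T P T_linear (P_linear tt).
have Q_scal a r x : scal a (Q r x) = Q r (scal a x).
  by symmetry; exact: (linear_scal _ (Q_linear r)).
have Q_norm := absorption_norm Lambda E i J E_energy J_energy E0 E0_unitary T P J_T (J_P tt).
have Q_cont := absorption_continuous Lambda E i J E_energy J_energy E0 E0_unitary T P
  T_linear (P_linear tt) J_T.
have [W [W' [W_lin [W'_lin [W'W [WW' [W_comm W_rate]]]]]]] :=
  scattering_operator (X := complete_real_form E) Q (rate b) (damping b) (2 * l)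
    (fun r => linear_real_form _ (Q_linear r)) Q_norm Q_cont (rate_continuous b b_cont)
    (rate_ge0 b b_pos) (damping_derive b b_cont) (damping_bound b l b_pos b_cont b_int)
    (2 * l) (damping_lim b l b_cont b_int).
have W_scal (a : scalars F) (x : E) : W (scal a x) = scal a (W x : E) :> E.
  have hl := linear_real_form (U := E) (V := E) _ (is_linear_scal_scalars a).
  exact: (W_comm _ hl (Q_scal a) x).
exists W, (2 * growth (2 * l)); split; [split; [|exists W'; split]|].
- split; [exact: (linear_plus _ W_lin)|exact: W_scal|exact: (linear_norm _ W_lin)].
- split; [exact: (linear_plus _ W'_lin)| |exact: (linear_norm _ W'_lin)].
  by move=> a x; rewrite -[in LHS](WW' x) -W_scal W'W.
- by [].
have g0 := growth_pos (2 * l).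
split; first lra.
move=> u0; split; last exact: (tail_integral_lim b l).
move=> u v hu hv t ht.
have [w [hw [w0 wE]]] := damped_evolves Lambda E i J E_energy J_energy E0 E0_unitary T P
  T_linear (P_linear tt) J_T (J_P tt) b b_cont u0 u hu.
have := W_rate w t hw ht; rewrite w0 wE // => hrate.
have vE := free_solution Lambda E i J E_energy J_energy E0 E0_unitary T J_T _ v t hv ht.
rewrite -(T_norm Lambda E i J E_energy J_energy E0 E0_unitary T J_T (- t)).
rewrite linear_minus // vE (T_inverse Lambda E i J E_energy J_energy E0 E0_unitary T J_T).
rewrite (tail_integralE b l) //; 
apply: (Rle_trans _ (growth (2 * l) * norm u0 * (2 * l - damping b t))); first exact: hrate.
right; field.
Qed.
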